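(* Consider the interconnected system $\dot x_i=f_i(x_1,\dots,x_n,u)$, $i=1,\dots,n$, and suppose that each subsystem is ISS, i.e. there exist $\beta_i\in\mathscr{KL}$, gains $\gamma_{ij}$ (each of class $\mathscr K$ or identically $0$, with $\gamma_{ii}\equiv0$) and $\gamma\in\mathscr K$ such that for every $i=1,\dots,n$ $$|x_i(t)|\le \beta_i(|x_i(0)|,t)+\sum_{j=1}^n\gamma_{ij}(\|x_{j,[0,t]}\|_\infty)+\gamma(\|u\|_\infty)\qquad\text{for all } t\ge 0 .$$ Let $\Gamma:\mathbb R^n_+\to\mathbb R^n_+$ be given by $\Gamma(s)=\big(\sum_{j}\gamma_{1j}(s_j),\dots,\sum_{j}\gamma_{nj}(s_j)\big)^T$. If there exist $\alpha_1,\dots,\alpha_n\in\mathscr K_\infty$ such that the mapping $D:\mathbb R^n_+\to\mathbb R^n_+$, $D(s)=(s_1+\alpha_1(s_1),\dots,s_n+\alpha_n(s_n))^T$, satisfies $$(\Gamma\circ D)(s)\not\ge s\qquad\text{for all } s\in\mathbb R^n_+\setminus\{0\},$$ then the composite system $\dot x=f(x,u)$, with $x=(x_1^T,\dots,x_n^T)^T$ and $f=(f_1^T,\dots,f_n^T)^T$, is ISS from $u$ to $x$.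
   Context: $\mathbb R_+=[0,\infty)$, $\mathbb R^n_+=\{x\in\mathbb R^n: x_i\ge0\ \forall i\}$. For $x,y\in\mathbb R^n$, $x\ge y$ means $x_i\ge y_i$ for all $i$; $x\not\ge y$ is the negation of this (some $i$ has $x_i<y_i$). A function $\mathbb R_+\to\mathbb R_+$ is of class $\mathscr K$ if it is continuous, (strictly) increasing and zero at $0$; of class $\mathscr K_\infty$ if in addition it is unbounded. A function $\beta:\mathbb R_+\times\mathbb R_+\to\mathbb R_+$ is of class $\mathscr{KL}$ if $\beta(\cdot,t)\in\mathscr K$ for each fixed $t$ and, for each fixed $s$, $\beta(s,\cdot)$ is non-increasing and tends to $0$ as $t\to\infty$. $|\cdot|$ denotes a norm, $\|\cdot\|_\infty$ the essential supremum norm on functions on $\mathbb R_+$, and $v_{[s_1,s_2]}$ is the function equal to $v$ on $[s_1,s_2]$ and $0$ elsewhere. Setting: $x_i\in\mathbb R^{N_i}$, $u\in\mathbb R^L$, and each $f_i:\mathbb R^{\sum_jN_j+L}\to\mathbb R^{N_i}$ is continuous and Lipschitz in the first $n$ arguments $(x_1,\dots,x_n)$ uniformly with respect to $u$. Inputs $u:\mathbb R_+\to\mathbb R^L$ are essentially bounded. In the ISS estimate for the $i$-th subsystem, $x_i(\cdot)$ is the solution of $\dot x_i=f_i(x_1,\dots,x_n,u)$ starting at $x_i(0)$, where the $x_j$, $j\ne i$, and $u$ are regarded as inputs of this subsystem. A system $\dot x=f(x,u)$ is ISS (input-to-state stable, from $u$ to $x$) if for all initial values $x_0$ and all essentially bounded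 inputs $u$ unique solutions $\xi(t;x_0,u)$ exist for all positive times, and there exist $\beta\in\mathscr{KL}$ and $\gamma\in\mathscr K$ such that $|\xi(t;x_0,u)|\le\beta(|x_0|,t)+\gamma(\|u\|_\infty)$ for all $t\ge0$, all $x_0$ and all essentially bounded $u$. *)

(* Defs.v *)
(* Vectors are columns; the interconnected state space is
   'cV[R]_(\sum_i N i), with blocks x_i given by submxcol / \mxcol. *)
From HB Require Import structures.
From mathcomp Require Import all_boot all_order all_algebra.
From mathcomp Require Import all_classical all_reals all_analysis ess_sup_inf.

Set Implicit Arguments.
Unset Strict Implicit.
Unset Printing Implicit Defensive.

Import Order.TTheory GRing.Theory Num.Theory.
Import numFieldNormedType.Exports.

Local Open Scope classical_set_scope.
Local Open Scope ring_scope.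

Section ComparisonFunctions.
Context {R : realType}.

(* Comparison functions live on [0, +oo[; they are represented by functions on
   R whose values at negative arguments are irrelevant. *)
Definition class_K (g : R -> R) : Prop :=
  [/\ g 0 = 0,
      {within `[0, +oo[, continuous g} &
      {in `[0, +oo[ &, {homo g : s t / s < t}}].

Definition class_Kinf (g : R -> R) : Prop :=
  class_K g /\ (forall M : R, exists2 s, 0 <= s & M < g s).

Definition class_KL (beta : R -> R -> R) : Prop :=
  (forall t, 0 <= t -> class_K (beta ^~ t)) /\
  (forall s, 0 <= s ->
    {in `[0, +oo[ &, {homo beta s : t1 t2 / t1 <= t2 >-> t2 <= t1}} /\
    beta s t @[t --> +oo] --> 0).

Definition class_K_or_zero (g : R -> R) : Prop :=
  class_K g \/ (forall s, 0 <= s -> g s = 0).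

End ComparisonFunctions.

Section SmallGainOperators.
Context {R : realType} {n : nat}.
Implicit Types (gain : 'I_n -> 'I_n -> R -> R) (alpha : 'I_n -> R -> R).

Definition vge (x y : 'cV[R]_n) : Prop := forall i, y i 0 <= x i 0.

Definition gain_op gain (s : 'cV[R]_n) : 'cV[R]_n :=
  \col_i \sum_(j < n) gain i j (s j 0).

Definition diag_op alpha (s : 'cV[R]_n) : 'cV[R]_n :=
  \col_i (s i 0 + alpha i (s i 0)).

End SmallGainOperators.

Section Systems.
Context {R : realType}.

Definition is_norm m (nu : 'cV[R]_m -> R) : Prop :=
  [/\ forall x, nu x = 0 -> x = 0,
      forall (a : R) x, nu (a *: x) = `|a| * nu x &
      forall x y, nu (x + y) <= nu x + nu y].

(* One norm |.| on each R^m. *)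
Variable nrm : forall m, 'cV[R]_m -> R.

(* v_[s1, s2] *)
Definition trunc m (s1 s2 : R) (v : R -> 'cV[R]_m) : R -> 'cV[R]_m :=
  patch (cst 0) `[s1, s2] v.

(* Functions on [0, +oo[ are represented by functions on R; values at negative
   times are discarded here. *)
Definition linf_norm m (v : R -> 'cV[R]_m) : \bar R :=
  ess_sup lebesgue_measure
    (fun t => (nrm (patch (cst 0) `[0, +oo[ v t))%:E).

(* Measurability is Borel measurability of the coordinates: every class of
   Lebesgue measurable functions modulo a.e. equality has such a
   representative, and both solutions and norms depend on the class only. *)
Definition ess_bounded m (v : R -> 'cV[R]_m) : Prop :=
  (forall k, measurable_fun (`[0, +oo[ : set R) (fun t => v t k 0)) /\
  (linf_norm v < +oo)%E.

(* Caratheodory solution of x' = g(t, x), x(0) = x0, on an interval J of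
   [0, +oo[ containing 0, in integral form: inputs are only measurable, so the
   differential equation holds almost everywhere. *)
Definition ode_solution m (g : R -> 'cV[R]_m -> 'cV[R]_m) (x0 : 'cV[R]_m)
    (J : set R) (x : R -> 'cV[R]_m) : Prop :=
  {within J, continuous x} /\
  (forall t, J t -> forall k : 'I_m,
     lebesgue_measure.-integrable `[0, t] (fun s => (g s (x s) k 0)%:E) /\
     x t k 0 = x0 k 0 + \int[lebesgue_measure]_(s in `[0, t]) g s (x s) k 0).

(* A solution exists for all positive times and every solution, even one only
   defined on some [0, b[, coincides with it. *)
Definition unique_global_solution m (g : R -> 'cV[R]_m -> 'cV[R]_m)
    (x0 : 'cV[R]_m) : Prop :=
  exists xi, ode_solution g x0 `[0, +oo[ xi /\
    (forall (b : R) y, ode_solution g x0 `[0, b[ y -> {in `[0, b[, y =1 xi}).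

Definition ISS m l (f : 'cV[R]_m -> 'cV[R]_l -> 'cV[R]_m) : Prop :=
  (forall x0 u, ess_bounded u ->
     unique_global_solution (fun t x => f x (u t)) x0) /\
  (exists beta gamma, [/\ class_KL beta, class_K gamma &
     forall x0 u xi, ess_bounded u ->
       ode_solution (fun t x => f x (u t)) x0 `[0, +oo[ xi ->
       forall t, 0 <= t ->
         nrm (xi t) <= beta (nrm x0) t + gamma (fine (linf_norm u))]).

(* On bounded sets of x the Lipschitz constant does not depend on u. *)
Definition lipschitz_on_bounded m p l (f : 'cV[R]_m -> 'cV[R]_l -> 'cV[R]_p)
    : Prop :=
  forall r : R, exists K : R, forall x y u, nrm x <= r -> nrm y <= r ->
    nrm (f x u - f y u) <= K * nrm (x - y).

Section Interconnection.
Variables (n l : nat) (N : 'I_n -> nat).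
Variable f : forall i, 'cV[R]_(\sum_j N j) -> 'cV[R]_l -> 'cV[R]_(N i).

Definition interconnection (x : 'cV[R]_(\sum_j N j)) (u : 'cV[R]_l)
    : 'cV[R]_(\sum_j N j) :=
  \mxcol_i f i x u.

(* The i-th subsystem, driven by x_j, j != i, and u; x i is not used. *)
Definition subsystem i (x : forall j, R -> 'cV[R]_(N j)) (u : R -> 'cV[R]_l)
    (t : R) (xi : 'cV[R]_(N i)) : 'cV[R]_(N i) :=
  f i (\mxcol_j dfwith (fun j => x j t) i xi j) (u t).

Definition subsystem_ISS i (beta : R -> R -> R) (gain : 'I_n -> R -> R)
    (gamma : R -> R) : Prop :=
  (forall x u, (forall j, j != i -> ess_bounded (x j)) -> ess_bounded u ->
     forall xi0, unique_global_solution (@subsystem i x u) xi0) /\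
  (forall x u, (forall j, j != i -> ess_bounded (x j)) -> ess_bounded u ->
     ode_solution (@subsystem i x u) (x i 0) `[0, +oo[ (x i) ->
     forall t, 0 <= t ->
       nrm (x i t) <= beta (nrm (x i 0)) t
         + \sum_(j < n) gain j (fine (linf_norm (trunc 0 t (x j))))
         + gamma (fine (linf_norm u))).

End Interconnection.
End Systems.

(* Main.v *)
Require Import Defs.
From HB Require Import structures.
From mathcomp Require Import all_boot all_order all_algebra.
From mathcomp Require Import all_classical all_reals all_analysis ess_sup_inf.
From mathcomp Require Import measurable_realfun ring lra.

(** The proof separates a nonlinear inequality on R^n from the dynamics.

    The inequality: if w >= 0 satisfies w <= Gamma(w) + c, then every w_i is at
    most phi(c), for a function phi that vanishes continuously at 0
    ([small_gain_bound]).  Put z = Gamma(w).  If c < alpha_i(z_i) for all i,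
    then w <= D(z), hence z <= Gamma(D(z)), which the small gain condition
    forbids.  So some z_i is at most alpha_i^-1(c), which bounds w_i; the terms
    gamma_ji(w_i) then join the constant c, and the argument repeats on the
    remaining indices.

    Stability: for a solution on [0, b[ and t < b, the suprema M_i of |x_i| over
    [0, t] satisfy M <= Gamma(M) + c, where
    c = sum_j beta_j(|x_j(0)|, 0) + gamma(||u||); therefore |x_i(t)| <= phi(c)
    ([block_stability]).  This a priori bound also gives global existence: a
    globally Lipschitz cut-off of the system has a solution by Picard iteration
    ([picard_existence]), and that solution never reaches the region where the
    cut-off differs from the system ([trapping],
    [interconnection_unique_global]).

    Attractivity, uniformly in the solution: let W_i(s) be the supremum of
    |x_i(t)| over t >= s and over all solutions with |x(0)| <= r and
    ||u|| <= v.  Restarting the subsystem estimates at time s gives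
    W_i(s + t) <= beta_i(B, t) + sum_j gamma_ij(W_j(s)) + gamma(v), with B the
    stability bound.  Letting t and then s tend to infinity, the limits of the
    W_i satisfy W <= Gamma(W) + gamma(v), so they are at most phi(gamma(v))
    ([uniform_attractivity]).

    Finally, the excess of |x(t')| over a suitable G(||u||), maximised over
    t' >= t and |x(0)| <= r, is bounded by a function of r alone, is
    non-increasing in t and tends to 0 as t tends to infinity.  It lacks only
    continuity and strict monotonicity in r to be of class KL, and an explicit
    regularisation supplies both ([KL_estimate], [class_KL_majorant]). *)

Set Implicit Arguments.
Unset Strict Implicit.
Unset Printing Implicit Defensive.

Import Order.TTheory GRing.Theory Num.Theory.
Import numFieldNormedType.Exports.

Local Open Scope classical_set_scope.
Local Open Scope ring_scope.

(** * Moduli and comparison functions *)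

Section Moduli.
Context {R : realType}.
Implicit Types (phi psi : R -> R) (a b c e r s t : R).

(** What remains of class K under suprema and generalized inverses, where
    continuity away from 0 and strict monotonicity are lost.  [class_K_majorant]
    and [class_KL_majorant] restore both. *)
Definition modulus phi : Prop :=
  [/\ phi 0 = 0,
      forall s t, 0 <= s -> s <= t -> phi s <= phi t &
      forall e, 0 < e -> exists2 d, 0 < d & phi d <= e].

Lemma modulus_ge0 phi s : modulus phi -> 0 <= s -> 0 <= phi s.
Proof. by move=> [p0 pm _] s0; rewrite -p0 pm. Qed.

Lemma modulus0 : modulus (fun=> 0).
Proof. by split=> // e e0; exists 1 => //; rewrite ltW. Qed.

Lemma modulus_id : modulus idfun.
Proof. by split=> // e e0; exists e. Qed.

Lemma modulusD phi psi :
  modulus phi -> modulus psi -> modulus (fun s => phi s + psi s).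
Proof.
move=> [p0 pm pc] [q0 qm qc]; split=> [|s t s0 st|e e0].
- by rewrite p0 q0 addr0.
- by rewrite lerD ?pm ?qm.
- have e2 : 0 < e / 2 by rewrite divr_gt0.
  have [d1 d1p h1] := pc _ e2; have [d2 d2p h2] := qc _ e2.
  exists (Num.min d1 d2); first by rewrite lt_min d1p.
  rewrite [e]splitr lerD//.
    by apply: le_trans h1; rewrite pm ?ge_min ?lexx// le_min !ltW.
  by apply: le_trans h2; rewrite qm ?ge_min ?lexx ?orbT// le_min !ltW.
Qed.

Lemma modulus_sum (I : Type) (l : seq I) (P : pred I) (phi : I -> R -> R) :
  (forall i, modulus (phi i)) ->
  modulus (fun s => \sum_(i <- l | P i) phi i s).
Proof.
move=> H; elim: l => [|i l IH].
  rewrite (_ : (fun s => _) = fun=> 0); first exact: modulus0.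
  by apply/funext => s; rewrite big_nil.
rewrite (_ : (fun s => _) = fun s => (if P i then phi i s else 0)
    + \sum_(j <- l | P j) phi j s); last first.
  by apply/funext => s; rewrite big_cons; case: ifP; rewrite ?add0r.
apply: modulusD => //; case: (P i) => //; exact: modulus0.
Qed.

Lemma modulus_comp phi psi :
  modulus phi -> modulus psi -> modulus (fun s => phi (psi s)).
Proof.
move=> pM qM; have [p0 pm pc] := pM; have [q0 qm qc] := qM.
split=> [|s t s0 st|e e0].
- by rewrite q0 p0.
- by rewrite pm ?qm// (modulus_ge0 qM).
- have [d1 d1p h1] := pc _ e0; have [d2 d2p h2] := qc _ d1p.
  by exists d2 => //; apply: le_trans h1; rewrite pm// (modulus_ge0 qM)// ltW.
Qed.

Lemma modulusZ a phi : 0 <= a -> modulus phi -> modulus (fun s => a * phi s).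
Proof.
move=> a0 [p0 pm pc]; split=> [|s t s0 st|e e0].
- by rewrite p0 mulr0.
- by rewrite ler_wpM2l ?pm.
- have a1 : 0 < a + 1 by rewrite ltr_wpDl.
  have [d dp h] := pc _ (divr_gt0 e0 a1); exists d => //.
  rewrite (le_trans (ler_wpM2l a0 h))// mulrA ler_pdivrMr// mulrDr mulr1.
  by rewrite mulrC lerDl ltW.
Qed.

Lemma class_K_modulus phi : class_K phi -> modulus phi.
Proof.
move=> [p0 /continuous_within_itvcyP [_ pc] pm]; split=> // [s t s0|e e0].
  rewrite le_eqVlt => /predU1P[->//|st].
  by rewrite ltW// pm// in_itv/= ?s0// (le_trans s0 (ltW st)).
move/cvgrPdist_le : pc => /(_ _ e0) [d /= dp h].
exists (d / 2); first by rewrite divr_gt0.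
have := h (d / 2); rewrite /= p0 sub0r normrN sub0r normrN => H.
apply: le_trans (ler_norm _) _; apply: H; last by rewrite divr_gt0.
by rewrite ger0_norm ?ltW ?divr_gt0//; lra.
Qed.

Lemma class_K_or_zero_modulus phi : class_K_or_zero phi -> modulus phi.
Proof.
move=> [/class_K_modulus//|h]; split=> [|s t s0 st|e e0].
  by rewrite h.
  by rewrite !h// (le_trans s0).
by exists 1 => //; rewrite h// ltW.
Qed.

(** The generalized inverse sup {s | phi s <= c}: it is finite because phi is
    unbounded, and it tends to 0 with c because phi is positive away from 0. *)
Lemma class_Kinf_inverse phi : class_Kinf phi ->
  exists2 rho, modulus rho &
    forall s c, 0 <= s -> 0 <= c -> phi s <= c -> s <= rho c.
Proof.
move=> [pK punb]; have [p0 pm pc] := class_K_modulus pK.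
have ppos s : 0 < s -> 0 < phi s.
  by case: pK => _ _ h s0; rewrite -[ltLHS]p0 h// in_itv/= ?lexx ?ltW.
pose S c := [set s | 0 <= s /\ phi s <= c].
have ubS c : has_ubound (S c).
  have [M M0 cM] := punb c; exists M => s [s0 sc].
  rewrite leNgt; apply/negP => Ms.
  by have := pm _ _ M0 (ltW Ms); rewrite leNgt (le_lt_trans sc cM).
have S0 c : 0 <= c -> S c 0 by rewrite /S/= p0.
have supS c : 0 <= c -> has_sup (S c) by move=> c0; split=> //; exists 0; exact: S0.
exists (fun c => sup (S c)); last first.
  by move=> s c s0 c0 sc; apply: ub_le_sup.
split=> [|s t s0 st|e e0].
- apply/eqP; rewrite eq_le; apply/andP; split; last exact/ub_le_sup/S0.
  apply: ge_sup; first by exists 0; exact: S0.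
  move=> s [s0 sc]; rewrite leNgt; apply/negP => /ppos.
  by rewrite ltNge sc.
- apply: ge_sup; first by exists 0; exact: S0.
  by move=> x [x0 xs]; apply: ub_le_sup => //; split=> //; exact: le_trans st.
- exists (phi e); first exact: ppos.
  apply: ge_sup; first by exists 0; apply/S0/ltW/ppos.
  move=> s [s0 sc]; rewrite leNgt; apply/negP => es.
  case: pK => _ _ /(_ e s); rewrite !in_itv/= !andbT (ltW e0) s0.
  by move=> /(_ isT isT es); rewrite ltNge sc.
Qed.

End Moduli.

Section Envelope.
Context {R : realType}.
Implicit Types (phi : R -> R) (a b c e r s t : R).

(** The weight min 1 (2 - s / r) is 1 for s <= r and decreases to 0 at s = 2 r.
    Hence the supremum lies between phi r and phi (2 r), and it depends on r only
    through a weight that is Lipschitz away from r = 0. *)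
Definition envelope phi r : R :=
  sup [set phi s * Num.min 1 (2 - s / r) | s in `[0, 2 * r]].

Let term phi r s := phi s * Num.min 1 (2 - s / r).

Lemma envelope_ub phi r s : modulus phi -> 0 <= s <= 2 * r ->
  phi s * Num.min 1 (2 - s / r) <= envelope phi r.
Proof.
move=> pM /andP[s0 sr]; have [p0 pm _] := pM.
apply: ub_le_sup; last by exists s => //=; rewrite in_itv/= s0.
exists (phi (2 * r)) => _ [x /= /[!in_itv]/= /andP[x0 xr] <-].
apply: (le_trans _ (pm _ _ x0 xr)).
by rewrite ler_piMr ?(modulus_ge0 pM)// ge_min lexx.
Qed.

Lemma envelope_le phi r c : 0 <= r ->
  (forall s, 0 <= s <= 2 * r -> phi s * Num.min 1 (2 - s / r) <= c) ->
  envelope phi r <= c.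
Proof.
move=> r0 H; apply: ge_sup.
  by exists (term phi r 0), 0 => //=; rewrite in_itv/= lexx mulr_ge0.
by move=> _ [x /= /[!in_itv]/= xr <-]; exact: H.
Qed.

Lemma envelope_ge phi r : modulus phi -> 0 <= r -> phi r <= envelope phi r.
Proof.
move=> pM; rewrite le_eqVlt => /predU1P[<-|r0].
  apply: le_trans (envelope_ub (s := 0) pM _); last by rewrite mulr0 lexx.
  by case: pM => -> _ _; rewrite mul0r.
apply: le_trans (envelope_ub (s := r) pM _).
  by rewrite divff ?gt_eqF// min_l ?mulr1//; lra.
by rewrite ltW//=; lra.
Qed.

Lemma envelope_le2 phi r : modulus phi -> 0 <= r -> envelope phi r <= phi (2 * r).
Proof.
move=> pM r0; apply: envelope_le => // s /andP[s0 sr].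
have [p0 pm _] := pM; apply: (le_trans _ (pm _ _ s0 sr)).
by rewrite ler_piMr ?(modulus_ge0 pM)// ge_min lexx.
Qed.

Lemma envelope_mono_fun phi psi r : modulus psi -> 0 <= r ->
  (forall s, 0 <= s -> phi s <= psi s) -> envelope phi r <= envelope psi r.
Proof.
move=> qM r0 pq; apply: envelope_le => // s /andP[s0 sr].
apply: le_trans (envelope_ub (s := s) qM _); last by rewrite s0.
have [w|w] := leP 0 (Num.min 1 (2 - s / r)); first by rewrite ler_wpM2r ?pq.
exfalso; move: w; rewrite gt_min ltr10/= subr_lt0.
have [r00|rn] := eqVneq r 0; first by rewrite r00 invr0 mulr0 ltNge ler0n.
have rp : 0 < r by rewrite lt_neqAle eq_sym rn.
by rewrite ltr_pdivlMr// ltNge sr.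
Qed.

Lemma envelope0 phi : modulus phi -> envelope phi 0 = 0.
Proof.
move=> pM; apply/eqP; rewrite eq_le; apply/andP; split.
  by apply: le_trans (envelope_le2 pM _) _ => //; rewrite mulr0; case: pM => ->.
by apply: le_trans (envelope_ge pM _) => //; case: pM => ->.
Qed.

Lemma envelope_homo phi r s : modulus phi -> 0 <= r -> r <= s ->
  envelope phi r <= envelope phi s.
Proof.
move=> pM r0 rs; have [r00|rn] := eqVneq r 0.
  rewrite r00 envelope0//; apply: le_trans (envelope_ge pM _).
    by rewrite (modulus_ge0 pM)// (le_trans r0).
  by rewrite (le_trans r0).
have rp : 0 < r by rewrite lt_neqAle eq_sym rn.
apply: envelope_le => // x /andP[x0 xr].
apply: le_trans (envelope_ub (s := x) pM _); last first.
  by rewrite x0 (le_trans xr)// ler_pM2l.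
rewrite ler_wpM2l ?(modulus_ge0 pM)// le_min !ge_min lexx/=.
by apply/orP; right; rewrite lerB// ler_wpM2l// lef_pV2 ?posrE ?(lt_le_trans rp).
Qed.

(** For fixed s <= 2 b, passing from r to a larger r' in [a, b] raises the weight
    by at most s / r - s / r' <= 2 b (r' - r) / a ^ 2. *)
Lemma envelope_lipschitz phi a b r s : modulus phi -> 0 < a ->
  a <= r -> r <= s -> s <= b ->
  envelope phi s <= envelope phi r + phi (2 * b) * (2 * b) / a ^+ 2 * (s - r).
Proof.
move=> pM a0 ar rs sb; have [p0 pm _] := pM.
have r0 : 0 < r := lt_le_trans a0 ar; have s0 : 0 < s := lt_le_trans r0 rs.
apply: envelope_le => [|x /andP[x0 xs]]; first exact: ltW.
have px : 0 <= phi x := modulus_ge0 pM x0.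
have gap : phi x * (x / r - x / s) <= phi (2 * b) * (2 * b) / a ^+ 2 * (s - r).
  have -> : x / r - x / s = x * (s - r) / (r * s).
    by field; rewrite !gt_eqF.
  have xb : x <= 2 * b by apply: le_trans xs _; rewrite ler_pM2l.
  have -> : phi (2 * b) * (2 * b) / a ^+ 2 * (s - r) =
      phi (2 * b) * (2 * b * (s - r) / a ^+ 2) by ring.
  have sr0 : 0 <= s - r by rewrite subr_ge0.
  have rs0 : 0 <= (r * s)^-1 by rewrite invr_ge0 mulr_ge0// ltW.
  apply: ler_pM => //; [by rewrite !mulr_ge0|by rewrite pm|].
  apply: ler_pM => //; [by rewrite mulr_ge0|by rewrite ler_wpM2r|].
  rewrite lef_pV2 ?posrE ?mulr_gt0 ?exprn_gt0// expr2.
  by rewrite ler_pM ?(ltW a0)// (le_trans ar).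
have [xr|xr] := leP x (2 * r).
  apply: (@le_trans _ _ (phi x * Num.min 1 (2 - x / r) + phi x * (x / r - x / s))).
    rewrite -mulrDr ler_wpM2l//; have : 0 <= x / r - x / s.
      by rewrite subr_ge0 ler_wpM2l// lef_pV2 ?posrE.
    by rewrite !minEle; do 2 case: ifPn; rewrite -?ltNge; lra.
  by rewrite lerD// envelope_ub// x0 xr.
apply: (@le_trans _ _ (phi x * (x / r - x / s))); last first.
  rewrite (le_trans gap)// lerDr (le_trans _ (envelope_ge pM _))//.
    by rewrite (modulus_ge0 pM)// ltW.
  exact: ltW.
rewrite ler_wpM2l// ge_min; apply/orP; right; rewrite lerD2r.
by rewrite ler_pdivlMr// ltW.
Qed.

Lemma envelope_continuous phi : modulus phi ->
  {within `[0, +oo[, continuous (envelope phi)}.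
Proof.
move=> pM; have [p0 pm pc] := pM; apply/continuous_within_itvcyP; split.
  move=> a; rewrite in_itv/= andbT => a0.
  pose L := phi (2 * (2 * a)) * (2 * (2 * a)) / (a / 2) ^+ 2.
  have L0 : 0 <= L.
    by rewrite /L !mulr_ge0 ?invr_ge0 ?exprn_ge0 ?(modulus_ge0 pM)// ltW//; lra.
  apply/cvgrPdist_le => e e0; near=> x.
  have ax : a / 2 <= x.
    near: x; exists (a / 2) => /=; first by rewrite divr_gt0.
    by move=> x /=; rewrite ltr_norml => /andP[h1 h2]; lra.
  have xa : x <= 2 * a.
    near: x; exists a => //=.
    by move=> x /=; rewrite ltr_norml => /andP[h1 h2]; lra.
  have hL : `|a - x| <= e / (L + 1).
    near: x; exists (e / (L + 1)) => /=; first by rewrite divr_gt0// ltr_wpDl.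
    by move=> x /= /ltW.
  have : `|envelope phi a - envelope phi x| <= L * `|a - x|.
    have lip y z : a / 2 <= y -> y <= z -> z <= 2 * a ->
        `|envelope phi z - envelope phi y| <= L * `|z - y|.
      move=> ay yz za; have y0 : 0 <= y by lra.
      rewrite !ger0_norm ?subr_ge0 ?envelope_homo// lerBlDl.
      by apply: envelope_lipschitz => //; lra.
    have [h|/ltW h] := leP x a; first by apply: lip => //; lra.
    by rewrite distrC [`|a - x|]distrC; apply: lip => //; lra.
  move=> /le_trans; apply; apply: le_trans (ler_wpM2l L0 hL) _.
  by rewrite mulrA ler_pdivrMr ?ltr_wpDl// mulrDr mulr1 mulrC lerDl ltW.
rewrite envelope0//; apply/cvgrPdist_le => e e0.
have [d d0 hd] := pc _ e0.
near=> x; have x0 : 0 < x by near: x; exact: nbhs_right_gt.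
rewrite sub0r normrN ger0_norm; last first.
  by rewrite (le_trans _ (envelope_ge pM _)) ?(modulus_ge0 pM) ?ltW.
apply: le_trans (envelope_le2 pM (ltW x0)) _; apply: le_trans hd.
rewrite pm ?mulr_ge0 ?ltW//.
have : x < d / 2 by near: x; apply: nbhs_right_lt; rewrite divr_gt0.
lra.
Unshelve. all: by end_near. Qed.

Lemma class_K_envelope phi c : 0 < c -> modulus phi ->
  class_K (fun r => envelope phi r + r * c).
Proof.
move=> c0 pM; split.
- by rewrite envelope0// mul0r addr0.
- move=> x; apply: cvgD; first exact: envelope_continuous.
  by apply: continuous_subspaceT x => y; exact: mulrr_continuous.
- move=> s t; rewrite !in_itv/= !andbT => s0 t0 st.
  by rewrite ler_ltD ?ltr_pM2r// envelope_homo// ltW.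
Qed.

Lemma class_K_majorant phi : modulus phi ->
  exists2 gamma, class_K gamma & forall s, 0 <= s -> phi s <= gamma s.
Proof.
move=> pM; exists (fun r => envelope phi r + r * 1); first exact: class_K_envelope.
by move=> s s0; rewrite (le_trans (envelope_ge pM s0))// lerDl mulr1.
Qed.

(** The envelope is taken in s at each fixed t.  The term s / (1 + t) makes the
    result strictly increasing in s and still tends to 0 in t. *)
Lemma class_KL_majorant (g : R -> R -> R) :
  (forall t, 0 <= t -> modulus (g ^~ t)) ->
  (forall s t1 t2, 0 <= s -> 0 <= t1 -> t1 <= t2 -> g s t2 <= g s t1) ->
  (forall s e, 0 <= s -> 0 < e -> exists2 T, 0 <= T & g s T <= e) ->
  exists2 beta, class_KL beta &
    forall s t, 0 <= s -> 0 <= t -> g s t <= beta s t.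
Proof.
move=> gM gt glim.
exists (fun s t => envelope (g ^~ t) s + s * (1 + t)^-1); last first.
  move=> s t s0 t0; rewrite (le_trans (envelope_ge (gM _ t0) s0))// lerDl.
  by rewrite mulr_ge0// invr_ge0 addr_ge0.
split=> [t t0|s s0].
  by apply: class_K_envelope (gM _ t0); rewrite invr_gt0 ltr_pwDl.
have anti t1 t2 : 0 <= t1 -> t1 <= t2 ->
    envelope (g^~ t2) s + s * (1 + t2)^-1 <= envelope (g^~ t1) s + s * (1 + t1)^-1.
  move=> h1 h12; apply: lerD.
    by apply: envelope_mono_fun => // [|x x0]; [exact: gM|exact: gt].
  rewrite ler_wpM2l// lef_pV2 ?posrE ?lerD2l// ltr_pwDl//.
  exact: le_trans h12.
split=> [t1 t2|]; first by rewrite !in_itv/= !andbT => h1 h2; exact: anti.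
apply/cvgrPdist_le => e e0.
have e2 : 0 < e / 2 by rewrite divr_gt0.
have [T T0 hT] := glim (2 * s) _ (mulr_ge0 (ler0n _ 2) s0) e2.
near=> t; have t0 : 0 <= t by near: t; apply: nbhs_pinfty_ge; rewrite num_real.
have Tt : T <= t by near: t; apply: nbhs_pinfty_ge; rewrite num_real.
have st : s / (e / 2) <= t by near: t; apply: nbhs_pinfty_ge; rewrite num_real.
have p1t : 0 < 1 + t by rewrite ltr_pwDl.
rewrite sub0r normrN ger0_norm; last first.
  apply: addr_ge0; last by rewrite mulr_ge0// invr_ge0 ltW.
  apply: le_trans (envelope_ge (gM _ t0) s0).
  exact: (modulus_ge0 (gM _ t0)).
rewrite [e]splitr; apply: lerD.
  apply: le_trans (envelope_le2 (gM _ t0) s0) _.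
  by apply: le_trans hT; apply: gt => //; rewrite mulr_ge0.
rewrite ler_pdivrMr// mulrDr mulr1.
move: st; rewrite ler_pdivrMr// mulrC => /le_trans; apply.
by rewrite lerDr ltW.
Unshelve. all: by end_near. Qed.

End Envelope.

(** * The small gain inequality *)

Section SmallGain.
Context {R : realType} {n : nat}.
Variables (gain : 'I_n -> 'I_n -> R -> R) (alpha : 'I_n -> R -> R).
Hypothesis gainK : forall i j, class_K_or_zero (gain i j).
Hypothesis alphaK : forall i, class_Kinf (alpha i).
Hypothesis small_gain : forall s : 'cV[R]_n, vge s 0 -> s <> 0 ->
  ~ vge ((gain_op gain \o diag_op alpha) s) s.

Let gainM i j : modulus (gain i j).
Proof. exact/class_K_or_zero_modulus/gainK. Qed.

Let alphaM i : modulus (alpha i).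
Proof. by apply/class_K_modulus; have [] := alphaK i. Qed.

(** If c < alpha_i(z_i) held on all of A, for z_i = sum_(j in A) gain_ij(w_j),
    then w <= z + c <= D(z) on A, so z <= Gamma(D(z)); extended by 0 outside A,
    the vector z would violate the small gain condition. *)
Lemma small_gain_component (A : {set 'I_n}) (i0 : 'I_n) (w : 'I_n -> R) (c : R) :
  i0 \in A -> 0 <= c -> (forall i, i \in A -> 0 <= w i) ->
  (forall i, i \in A -> w i <= \sum_(j in A) gain i j (w j) + c) ->
  exists2 i, i \in A & alpha i (\sum_(j in A) gain i j (w j)) <= c.
Proof.
move=> i0A c0 w0 wle; apply: contrapT => H.
pose z i := if i \in A then \sum_(j in A) gain i j (w j) else 0.
have z0 i : 0 <= z i.
  rewrite /z; case: ifP => // iA; apply: sumr_ge0 => j jA.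
  by rewrite (modulus_ge0 (gainM _ _))// w0.
have cz i : i \in A -> c < alpha i (z i).
  move=> iA; rewrite ltNge; apply/negP => ac; apply: H; exists i => //.
  by move: ac; rewrite /z iA.
have a0 i : 0 <= z i + alpha i (z i).
  by rewrite addr_ge0// (modulus_ge0 (alphaM i)).
have := @small_gain (\col_i z i); apply.
- by move=> i; rewrite !mxE.
- move=> /colP /(_ i0); rewrite !mxE => zi0.
  have := cz _ i0A; rewrite zi0; have [-> _ _] := alphaM i0.
  by rewrite ltNge c0.
- move=> i; rewrite /= !mxE.
  under eq_bigr do rewrite !mxE.
  rewrite {1}/z; case: ifPn => [iA|_]; last first.
    by apply: sumr_ge0 => j _; exact: (modulus_ge0 (gainM _ _)).
  apply: (@le_trans _ _ (\sum_(j in A) gain i j (z j + alpha j (z j)))).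
    apply: ler_sum => j jA; have [_ gm _] := gainM i j; apply: gm; first exact: w0.
    have := wle _ jA; rewrite /z jA => /le_trans; apply; rewrite lerD2l.
    by have := cz _ jA; rewrite /z jA => /ltW.
  rewrite [leRHS](bigID (mem A))/= lerDl; apply: sumr_ge0 => j _.
  exact: (modulus_ge0 (gainM _ _)).
Qed.

(** Induction on the number of indices: an index i with alpha_i(z_i) <= c has
    w_i <= rho_i(c) + c with rho_i the inverse of alpha_i, so the terms
    gain_ji(w_i) can be added to the constant c and i can be removed from A. *)
Lemma small_gain_bound (A : {set 'I_n}) :
  exists2 phi, modulus phi &
    forall (w : 'I_n -> R) (c : R), 0 <= c ->
      (forall i, i \in A -> 0 <= w i) ->
      (forall i, i \in A -> w i <= \sum_(j in A) gain i j (w j) + c) ->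
      forall i, i \in A -> w i <= phi c.
Proof.
move: {2}#|A| (erefl #|A|) => k; elim: k A => [|k IH] A Ak.
  exists (fun=> 0); first exact: modulus0.
  by move=> w c _ _ _ i; rewrite (cards0_eq Ak) inE.
have {}IH i : exists phi, modulus phi /\ (i \in A ->
    forall (w : 'I_n -> R) (c : R), 0 <= c ->
      (forall i', i' \in A :\ i -> 0 <= w i') ->
      (forall i', i' \in A :\ i ->
         w i' <= \sum_(j in A :\ i) gain i' j (w j) + c) ->
      forall i', i' \in A :\ i -> w i' <= phi c).
  have [iA|iA] := boolP (i \in A); last by exists (fun=> 0); split=> //; exact: modulus0.
  have [|phi pM pP] := IH (A :\ i); last by exists phi.
  by move: Ak; rewrite (cardsD1 i) iA add1n => -[].
have /choice[phi /all_and2[phiM phiP]] := IH.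
have inv i : exists rho, modulus rho /\
    forall s c, 0 <= s -> 0 <= c -> alpha i s <= c -> s <= rho c.
  by have [rho] := class_Kinf_inverse (alphaK i); exists rho.
have /choice[rho /all_and2[rhoM rhoP]] := inv.
pose b i c := rho i c + c.
have bM i : modulus (b i) by apply: modulusD => //; exact: modulus_id.
pose d i c := c + \sum_(j in A) gain j i (b i c).
have dM i : modulus (d i).
  apply: modulusD; first exact: modulus_id.
  by apply: modulus_sum => j; apply: (modulus_comp (gainM j i) (bM i)).
have pdM i : modulus (fun c => b i c + phi i (d i c)).
  by apply: modulusD => //; exact: modulus_comp.
(* The index removed from A depends on w, so the bounds obtained from all
   possible choices are added up. *)
exists (fun c => \sum_i (b i c + phi i (d i c))); first exact: modulus_sum.
move=> w c c0 w0 wle i iA.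
have [i1 i1A ai1] := small_gain_component iA c0 w0 wle.
have w1 : w i1 <= b i1 c.
  apply: le_trans (wle _ i1A) _; rewrite lerD2r; apply: rhoP => //.
  by apply: sumr_ge0 => j jA; rewrite (modulus_ge0 (gainM _ _))// w0.
rewrite (bigD1 i1)//=; apply: ler_wpDr.
  by apply: sumr_ge0 => j _; apply: (modulus_ge0 (pdM j)).
have [->|ii1] := eqVneq i i1.
  by apply: ler_wpDr => //; apply: (modulus_ge0 (phiM _)); exact: (modulus_ge0 (dM _)).
apply: ler_wpDl; first exact: (modulus_ge0 (bM _)).
apply: (phiP i1 i1A w); first exact: (modulus_ge0 (dM _)).
- by move=> j; rewrite !inE => /andP[_]; exact: w0.
- move=> j; rewrite !inE => /andP[_ jA].
  apply: le_trans (wle _ jA) _; rewrite (big_setD1 i1)//= addrAC addrC lerD2l.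
  rewrite addrC lerD2l (bigD1 j)//=; apply: ler_wpDr.
    apply: sumr_ge0 => k' _; apply: (modulus_ge0 (gainM _ _)).
    exact: (modulus_ge0 (bM _)).
  by have [_ gm _] := gainM j i1; apply: gm => //; exact: w0.
- by rewrite !inE ii1.
Qed.

End SmallGain.

(** * Norms on column vectors *)

Section Norms.
Context {R : realType}.

Lemma mx_entry_le m p (x : 'M[R]_(m, p)) i j : `|x i j| <= `|x|.
Proof.
rewrite [leRHS]/Num.norm /= mx_normrE; apply: (le_trans _ (le_bigmax _ _ (i, j))).
by [].
Qed.

Lemma mx_norm_le m p (x : 'M[R]_(m, p)) c :
  0 <= c -> (forall i j, `|x i j| <= c) -> `|x| <= c.
Proof.
by move=> c0 H; rewrite [leLHS]/Num.norm /= mx_normrE; apply: bigmax_le => // -[].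
Qed.

Lemma near_dist_lt (V : normedModType R) (x : V) e :
  0 < e -> \forall y \near x, `|x - y| < e.
Proof. by move: e; apply/cvgrPdist_lt; exact: cvg_id. Qed.

Lemma trmx_continuous m p : continuous (fun x : 'M[R]_(m, p) => x^T).
Proof.
move=> x; apply/(@cvgrPdist_lt _ _ _ (nbhs x) (nbhs_filter x)) => e e0.
have := @near_dist_lt _ x e e0; apply: filterS => y xy.
apply: le_lt_trans xy; apply: mx_norm_le => // i j.
by have := mx_entry_le (x - y) j i; rewrite !mxE.
Qed.

Lemma cV_ball_compact m (r : R) : compact [set x : 'cV[R]_m | `|x| <= r].
Proof.
have -> : [set x : 'cV[R]_m | `|x| <= r] =
    (fun x : 'rV[R]_m => x^T) @` [set x : 'rV[R]_m | `|x| <= r].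
  have tr p q (x : 'M[R]_(p, q)) : `|x^T| <= `|x|.
    by apply: mx_norm_le => // i j; rewrite mxE mx_entry_le.
  apply/seteqP; split=> [x /= xr|_ [x /= xr <-]]; last exact: le_trans (tr _ _ _) xr.
  by exists x^T; rewrite ?trmxK//= (le_trans (tr _ _ _)).
apply: continuous_compact.
  by apply: continuous_subspaceT; exact: trmx_continuous.
apply: bounded_closed_compact.
  exists r; split; first exact: num_real.
  by move=> M rM x /= /le_trans; apply; exact: ltW.
rewrite (_ : [set x | _] = Num.norm @^-1` [set y | y <= r])//.
apply: preimage_closed => [x _|]; last exact: closed_le.
exact: norm_continuous.
Unshelve. all: by end_near. Qed.

Variables (m : nat) (nu : 'cV[R]_m -> R).
Hypothesis nuN : is_norm nu.

Lemma is_norm0 : nu 0 = 0.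
Proof. by case: nuN => _ /(_ 0 0); rewrite scaler0 normr0 mul0r. Qed.

Lemma is_normN x : nu (- x) = nu x.
Proof. by case: nuN => _ /(_ (-1) x); rewrite scaleN1r normrN1 mul1r. Qed.

Lemma is_norm_ge0 x : 0 <= nu x.
Proof.
case: nuN => _ _ /(_ x (- x)); rewrite subrr is_norm0 is_normN => h.
by rewrite -(pmulrn_lge0 _ (ltn0Sn 1)) mulr2n.
Qed.

(** Expansion of x in the canonical basis. *)
Lemma is_norm_le_mx_norm : exists2 C, 0 < C & forall x, nu x <= C * `|x|.
Proof.
case: (nuN) => _ nuZ nuD.
pose C0 := \sum_(k < m) nu (delta_mx k 0).
have C00 : 0 <= C0 by apply: sumr_ge0 => k _; exact: is_norm_ge0.
exists (C0 + 1) => [|x]; first by rewrite ltr_wpDl.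
apply: (@le_trans _ _ (C0 * `|x|)); last first.
  by rewrite ler_wpM2r// lerDl.
rewrite {1}(matrix_sum_delta x) mulr_suml.
apply: (@le_trans _ _ (\sum_i nu (x i 0 *: delta_mx i 0))).
  elim/big_ind2 : _ => [|a b c d h1 h2|i _]; first by rewrite is_norm0.
    by apply: le_trans (nuD _ _) _; exact: lerD.
  by rewrite big_ord1.
by apply: ler_sum => i _; rewrite nuZ mulrC ler_wpM2l ?is_norm_ge0// mx_entry_le.
Qed.

Lemma is_norm_dist x y : `|nu x - nu y| <= nu (x - y).
Proof.
case: (nuN) => _ _ nuD.
have H a b : nu a - nu b <= nu (a - b) by rewrite lerBlDr -{1}[a](subrK b) nuD.
by rewrite ler_norml H andbT lerNl opprB -[nu (x - y)]is_normN opprB H.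
Qed.

Lemma is_norm_continuous : continuous nu.
Proof.
have [C C0 hC] := is_norm_le_mx_norm.
move=> x; apply/(@cvgrPdist_lt _ _ _ (nbhs x) (nbhs_filter x)) => e e0.
have := @near_dist_lt _ x (e / C) (divr_gt0 e0 C0); apply: filterS => y xy.
apply: le_lt_trans (is_norm_dist _ _) _; apply: le_lt_trans (hC _) _.
by rewrite mulrC -ltr_pdivlMr.
Qed.

(** By compactness of the unit sphere, on which the continuous function 1 / nu
    is bounded. *)
Lemma mx_norm_le_is_norm : exists2 C, 0 < C & forall x, `|x| <= C * nu x.
Proof.
case: (nuN) => nu0 nuZ _.
pose S := [set x : 'cV[R]_m | `|x| <= 1] `&` [set x | 1 <= `|x|].
have cS : compact S.
  apply: compact_closedI; first exact: cV_ball_compact.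
  rewrite (_ : [set x | _] = Num.norm @^-1` [set y | 1 <= y])//.
  apply: preimage_closed => [x _|]; last exact: closed_ge.
  exact: norm_continuous.
have Sn x : S x -> nu x != 0.
  move=> [/= _ x1]; apply/eqP => /nu0 x0; move: x1.
  by rewrite x0 normr0 ltNge ler01 || rewrite x0 normr0 ler10.
have cSV : compact ((fun x => (nu x)^-1) @` S).
  apply: continuous_compact cS; apply: continuous_in_subspaceT => x /set_mem Sx.
  apply: (@cvgV _ _ (nbhs x) (nbhs_filter x)); first exact: Sn.
  exact: is_norm_continuous.
have [M [_ HM]] := compact_bounded cSV.
exists (`|M| + 1); first by rewrite ltr_wpDl.
move=> x; have [->|x0] := eqVneq x 0.
  by rewrite normr0 mulr_ge0 ?is_norm_ge0// addr_ge0.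
have nx : 0 < `|x| by rewrite normr_gt0.
have nu_x : 0 < nu x.
  rewrite lt_neqAle is_norm_ge0 andbT eq_sym; apply/eqP => /nu0 /eqP.
  by rewrite (negbTE x0).
have := HM (`|M| + 1) (le_lt_trans (ler_norm _) (ltr_pwDr ltr01 (lexx _))).
move=> /(_ ((nu (`|x|^-1 *: x))^-1)) /=.
rewrite nuZ normfV normr_id invfM invrK normrM normr_id.
rewrite [`|(nu x)^-1|]ger0_norm ?invr_ge0 ?is_norm_ge0//.
rewrite ler_pdivrMr//; apply; exists (`|x|^-1 *: x).
  by split => /=; rewrite normrZ normfV normr_id mulVf ?gt_eqF.
by rewrite nuZ normfV normr_id invfM invrK.
Qed.

End Norms.

(** * Measurability and translation *)

Section Measurability.
Context {R : realType}.

Lemma bigcup_countType_measurable d (T : measurableType d) (I : countType)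
    (P : I -> Prop) (A : I -> set T) :
  (forall i, measurable (A i)) -> measurable (\bigcup_(i in [set i | P i]) A i).
Proof.
move=> mA.
rewrite (_ : \bigcup_(i in [set i | P i]) A i =
    \bigcup_n [set x | exists i, [/\ unpickle n = Some i, P i & A i x]]).
  apply: bigcupT_measurable => n; case E : (unpickle n : option I) => [i|].
    have [Pi|Pi] := pselect (P i).
      rewrite (_ : [set x | _] = A i)//; apply/seteqP; split=> x /=.
        by move=> [j [[<-]]].
      by move=> Ax; exists i.
    rewrite (_ : [set x | _] = set0)//; apply/seteqP; split=> x //=.
    by move=> [j [[<-]]].
  by rewrite (_ : [set x | _] = set0)//; apply/seteqP; split=> x //= [j []].
apply/seteqP; split=> x.
  by move=> [i /= Pi Ax]; exists (pickle i) => //=; exists i; rewrite pickleK.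
by move=> [n _ /= [i [_ Pi Ax]]]; exists i.
Qed.

Lemma rational_cV_dense m (x : 'cV[R]_m) (e : R) : 0 < e ->
  exists q : 'cV[rat]_m, forall k, `|x k 0 - ratr (q k 0)| < e.
Proof.
move=> e0.
have H k : exists q : rat, `|x k 0 - ratr q| < e.
  have : x k 0 - e < x k 0 + e by lra.
  by move=> /rat_in_itvoo[q] /[!in_itv]/= qx; exists q; rewrite ltr_distlC.
have /choice[q qP] := H; exists (\col_k q k) => k; rewrite mxE; exact: qP.
Qed.

(** The open set {G > a} is a union of countably many boxes with rational
    centres, and the preimage of a box is a finite intersection of preimages of
    intervals under the coordinates. *)
Lemma measurable_fun_continuous_coord d (T : measurableType d) (D : set T)
    m p (G : 'cV[R]_m * 'cV[R]_p -> R) (h1 : T -> 'cV[R]_m) (h2 : T -> 'cV[R]_p) :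
  measurable D -> continuous G ->
  (forall k, measurable_fun D (fun s => h1 s k 0)) ->
  (forall k, measurable_fun D (fun s => h2 s k 0)) ->
  measurable_fun D (fun s => G (h1 s, h2 s)).
Proof.
move=> mD cG m1 m2 _.
apply: (measurability _ (RGenOInfty.measurableE R)) => // _ [_ [a ->] <-].
pose idx := ('cV[rat]_m * 'cV[rat]_p * nat)%type.
pose near1 (q : idx) (x : 'cV[R]_m) := forall k, `|x k 0 - ratr (q.1.1 k 0)| < q.2.+1%:R^-1.
pose near2 (q : idx) (x : 'cV[R]_p) := forall k, `|x k 0 - ratr (q.1.2 k 0)| < q.2.+1%:R^-1.
rewrite (_ : _ `&` _ = \bigcup_(q in [set q : idx | forall x y, near1 q x ->
   near2 q y -> a < G (x, y)]) (D `&` [set s | near1 q (h1 s) /\ near2 q (h2 s)])).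
  apply: bigcup_countType_measurable => q.
  have mnear k' (h : T -> 'cV[R]_k') (c : 'cV[rat]_k') (e : R) :
      (forall k, measurable_fun D (fun s => h s k 0)) ->
      measurable (D `&` [set s | forall k, `|h s k 0 - ratr (c k 0)| < e]).
    move=> mh.
    have [[k0 _]|nk] := pselect (exists k : 'I_k', True); last first.
      rewrite (_ : _ `&` _ = D)//; apply/seteqP; split=> [s []//|s Ds].
      by split=> // k; exfalso; apply: nk; exists k.
    rewrite (_ : _ `&` _ = \bigcap_(k in [set: 'I_k'])
        (D `&` [set s | `|h s k 0 - ratr (c k 0)| < e])).
      apply: fin_bigcap_measurable; first exact: finite_finset.
      move=> k _.
      rewrite (_ : [set s | _] = (fun s => h s k 0) @^-1` (ball (ratr (c k 0) : R) e)).
        by apply: (mh k) => //; exact: measurable_ball.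
      by apply/seteqP; split=> s /=; rewrite /ball/= distrC.
    apply/seteqP; split=> [s [Ds hs] k _|s hs]; first by split=> //; exact: hs.
    split=> [|k]; first by have [] := hs k0 I.
    by have [] := hs k I.
  rewrite (_ : D `&` _ = (D `&` [set s | near1 q (h1 s)]) `&`
      (D `&` [set s | near2 q (h2 s)])).
    by apply: measurableI; exact: mnear.
  by apply/seteqP; split=> s /=; rewrite ?/setI/=; tauto.
apply/seteqP; split=> s /=; last first.
  move=> [q /= qG [Ds [n1 n2]]]; split=> //.
  by rewrite in_itv/= andbT; exact: qG.
move=> [Ds]; rewrite in_itv/= andbT => aG.
have /cvgrPdist_lt /(_ (G (h1 s, h2 s) - a)) := cG (h1 s, h2 s).
rewrite subr_gt0 => /(_ aG) /nbhs_ballP[e /= e0 He].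
have [j je] : exists j : nat, j.+1%:R^-1 < e / 2.
  have [j _ jP] := near_infty_natSinv_lt (PosNum (divr_gt0 e0 (@ltr0Sn R 1))).
  by exists j; apply: jP => /=.
have j0 : 0 < (j.+1%:R^-1 : R) by rewrite invr_gt0.
have [q1 q1P] := rational_cV_dense (h1 s) j0.
have [q2 q2P] := rational_cV_dense (h2 s) j0.
exists ((q1, q2), j) => /=; last by split.
move=> x y nx ny.
have bnd k' (z w : 'cV[R]_k') (c : 'cV[rat]_k') :
    (forall k, `|z k 0 - ratr (c k 0)| < j.+1%:R^-1) ->
    (forall k, `|w k 0 - ratr (c k 0)| < j.+1%:R^-1) -> ball z e w.
  move=> zc wc; split=> // i i'; rewrite ord1 /ball/=.
  have := ler_distD (ratr (c i 0)) (z i 0) (w i 0).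
  move: (zc i) (wc i) je; rewrite [`|w i 0 - _|]distrC.
  by move: (j.+1%:R^-1) => u; lra.
have := He (x, y); rewrite /ball/= => /(_ _)/wrap[]; last first.
  by have := ler_norm (G (h1 s, h2 s) - G (x, y)); lra.
by split; [exact: bnd q1P nx|exact: bnd q2P ny].
Qed.

End Measurability.

Section Translation.
Context {R : realType}.
Notation mu := (@lebesgue_measure R).
Variable a : R.

Let shift (s : measurableTypeR R) : measurableTypeR R := s + a.

Lemma measurable_shift : measurable_fun setT shift.
Proof. by apply: measurable_funD. Qed.

Let shiftM : {mfun measurableTypeR R >-> measurableTypeR R} :=
  HB.pack shift (isMeasurableFun.Build _ _ _ _ _ measurable_shift).

(** Two measures that agree on half-open intervals agree on Borel sets. *)
Lemma lebesgue_measure_shift (A : set R) : measurable A ->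
  mu (shift @^-1` A) = mu A.
Proof.
move=> mA; apply/esym.
apply: (@lebesgue_measure_unique _ (pushforward mu shiftM)) => // X.
move=> /ocitvP[->|[[b c] /= bc ->]]; first by rewrite !measure0.
rewrite /pushforward (_ : shiftM @^-1` _ = `]b - a, c - a]%classic).
  rewrite !lebesgue_measure_itv/= !lte_fin ltrD2r; case: ifPn => // _.
  by rewrite -!EFinD opprD opprK addrACA addNr addr0.
apply/seteqP; split=> s /=; rewrite !in_itv/= /shift => /andP[h1 h2]; apply/andP; split; lra.
Qed.

Lemma ae_shift (P : R -> Prop) :
  {ae mu, forall s, P s} -> {ae mu, forall s, P (s + a)}.
Proof.
move=> [A [mA A0 PA]]; exists (shift @^-1` A); split.
- by rewrite -[X in measurable X]setTI; exact: measurable_shift.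
- by rewrite lebesgue_measure_shift.
- by move=> s /= Ps; apply: PA.
Qed.

Lemma ge0_integral_shift (D : set R) (f : R -> \bar R) :
  measurable D -> measurable_fun D f -> (forall s, D s -> 0 <= f s)%E ->
  (\int[mu]_(s in shift @^-1` D) f (shift s) = \int[mu]_(s in D) f s)%E.
Proof.
move=> mD mf f0.
rewrite -(@ge0_integral_pushforward _ _ _ _ _ _ measurable_shift mu D f mD mf); last first.
  by move=> s /set_mem; exact: f0.
have := @eq_measure_integral _ (measurableTypeR R) R D lebesgue_measure
  (pushforward mu shiftM) f.
apply=> A mA _; exact: lebesgue_measure_shift.
Qed.

Lemma integrable_shift (D : set R) (f : R -> \bar R) :
  measurable D -> mu.-integrable D f ->
  mu.-integrable (shift @^-1` D) (fun s => f (shift s)).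
Proof.
move=> mD /integrableP[mf fi].
have mD' : measurable (shift @^-1` D).
  by rewrite -[X in measurable X]setTI; exact: measurable_shift.
apply/integrableP; split.
  move=> _ B mB; rewrite (_ : _ `&` _ = shift @^-1` (D `&` f @^-1` B))//.
  by rewrite -[X in measurable X]setTI; apply: measurable_shift => //; exact: mf.
rewrite (@ge0_integral_shift D (fun s => `|f s|%E))//.
exact: measurableT_comp.
Qed.

Lemma integral_shift (D : set R) (f : R -> \bar R) :
  measurable D -> mu.-integrable D f ->
  (\int[mu]_(s in shift @^-1` D) f (shift s) = \int[mu]_(s in D) f s)%E.
Proof.
move=> mD /integrableP[mf fi].
rewrite integralE [RHS]integralE -(@ge0_integral_shift D (f^\+)%E)//; last first.
  exact: measurable_funepos.
rewrite -(@ge0_integral_shift D (f^\-)%E)//; last exact: measurable_funeneg.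
by rewrite funepos_comp funeneg_comp.
Qed.

Lemma Rintegral_shift (t : R) (f : R -> R) :
  mu.-integrable `[a, t + a] (EFin \o f) ->
  mu.-integrable `[0, t] (fun s => (f (s + a))%:E) /\
  \int[mu]_(s in `[0, t]) f (s + a) = \int[mu]_(s in `[a, t + a]) f s.
Proof.
have E : shift @^-1` `[a, t + a] = `[0, t]%classic.
  by apply/seteqP; split=> s /=; rewrite /shift !in_itv/= => /andP[h1 h2]; apply/andP; split; lra.
move=> fi; split; first by rewrite -E; exact: (integrable_shift _ fi).
by rewrite -E; congr fine; exact: (integral_shift _ fi).
Qed.

End Translation.

(** * Continuity on intervals *)

Section WithinContinuity.
Context {R : realType}.

Lemma within_continuousP (V : normedModType R) (A : set R) (x : R -> V) :
  {within A, continuous x} <->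
  forall t, A t -> forall e, 0 < e ->
    exists2 d, 0 < d & forall s, A s -> `|t - s| < d -> `|x t - x s| <= e.
Proof.
have E (t : R) : A t -> (x @ (t : subspace A) --> x t) <-> (x @ within A (nbhs t) --> x t).
  by move=> At; rewrite (nbhs_subspace_in At).
rewrite continuous_subspace_in; split=> [H t At e e0|H t /set_mem At].
  have /(E _ At)/cvgrPdist_le/(_ e e0)/nbhs_ballP[d /= d0 Hd] := H t (mem_set At).
  by exists d => // s As ts; exact: Hd.
apply/(E _ At)/cvgrPdist_le => e e0; have [d d0 Hd] := H t At e e0.
by apply/nbhs_ballP; exists d => // s ts As; exact: Hd.
Qed.

Lemma within_continuous_subset (V : normedModType R) (A B : set R) (x : R -> V) :
  A `<=` B -> {within B, continuous x} -> {within A, continuous x}.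
Proof. exact: continuous_subspaceW. Qed.

Lemma within_continuous_coord m (A : set R) (x : R -> 'cV[R]_m) :
  {within A, continuous x} -> forall k, {within A, continuous (fun s => x s k 0)}.
Proof.
move=> /within_continuousP H k; apply/within_continuousP => t At e e0.
have [d d0 Hd] := H t At e e0; exists d => // s As ts.
by apply: le_trans (Hd s As ts); have := mx_entry_le (x t - x s) k 0; rewrite !mxE.
Qed.

Lemma within_continuous_cV m (A : set R) (x : R -> 'cV[R]_m) :
  (forall k, {within A, continuous (fun s => x s k 0)}) ->
  {within A, continuous x}.
Proof.
move=> H; apply/within_continuousP => t At e e0.
have /choice[d dP] : forall k, exists d, 0 < d /\
    forall s, A s -> `|t - s| < d -> `|x t k 0 - x s k 0| <= e.
  move=> k; have /within_continuousP /(_ t At e e0)[d d0 Hd] := H k.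
  by exists d.
exists (\big[Num.min/1]_k d k).
  by apply/bigmin_gtP; split=> // k _; have [] := dP k.
move=> s As ts; apply: mx_norm_le => [|i j]; first exact: ltW.
rewrite !mxE ord1; have [_ H2] := dP i; apply: H2 => //.
exact: lt_le_trans ts (bigmin_le _ _ _).
Qed.

(** For an initial segment A that is right-open, such as [0, +oo[ or [0, b[:
    continuity at t only involves an interval [0, T] with T > t. *)
Lemma within_continuous_exhaust (V : normedModType R) (A : set R) (x : R -> V) :
  (forall t, A t -> 0 <= t) ->
  (forall t, A t -> exists2 T, t < T & `[0, T] `<=` A) ->
  (forall T, A T -> {within `[0, T], continuous x}) ->
  {within A, continuous x}.
Proof.
move=> A0 AT H; apply/within_continuousP => t At e e0.
have [T tT TA] := AT t At.
have t0 := A0 _ At; have AT' : A T.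
  by apply: TA; rewrite /= in_itv/= lexx andbT (le_trans t0)// ltW.
have /within_continuousP /(_ t _ e e0) := H T AT'.
have tin : `[0, T]%classic t by rewrite /= in_itv/= t0 ltW.
move=> /(_ tin) [d d0 Hd].
exists (Num.min d (T - t)); first by rewrite lt_min d0 subr_gt0.
move=> s As; rewrite lt_min => /andP[h1 h2]; apply: Hd => //.
rewrite /= in_itv/= A0//=; move: h2; rewrite ltr_norml; lra.
Qed.

Lemma within_continuous_bounded (V : normedModType R) (a b : R) (x : R -> V) :
  {within `[a, b], continuous x} ->
  exists2 M, 0 < M & forall s, a <= s <= b -> `|x s| <= M.
Proof.
move=> cx.
have /compact_bounded[M [_ HM]] := continuous_compact cx (segment_compact (a := a) (b := b)).
exists (`|M| + 1) => [|s sab]; first by rewrite ltr_wpDl.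
apply: HM; first by rewrite (le_lt_trans (ler_norm _))// ltrDl.
by exists s => //=; rewrite in_itv.
Qed.

Lemma within_continuous_measurable (A : set R) (x : R -> R) :
  measurable A -> {within A, continuous x} -> measurable_fun A x.
Proof. by move=> mA cx; exact: subspace_continuous_measurable_fun. Qed.

Lemma clamp_lipschitz (a b s t : R) :
  `|Num.max a (Num.min s b) - Num.max a (Num.min t b)| <= `|s - t|.
Proof.
have h1 := ler_norm (s - t); have := ler_norm (t - s); rewrite distrC => h2.
rewrite ler_norml !maxEle !minEle.
by repeat case: ifPn; rewrite -?ltNge => *; apply/andP; split; lra.
Qed.

(** The extension of a path on [0, T] by its end values: it makes a solution
    known on a bounded interval an admissible input for a subsystem. *)
Definition freeze (V : Type) (T : R) (x : R -> V) : R -> V :=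
  fun s => x (Num.max 0 (Num.min s T)).

Lemma freeze_id V (T : R) (x : R -> V) s : 0 <= s <= T -> freeze T x s = x s.
Proof. by move=> /andP[s0 sT]; rewrite /freeze min_l// max_r. Qed.

Lemma freeze_in (T s : R) : 0 <= T -> 0 <= Num.max 0 (Num.min s T) <= T.
Proof. by move=> T0; rewrite le_max lexx/= ge_max T0 ge_min lexx orbT. Qed.

Lemma freeze_continuous (V : normedModType R) (T : R) (x : R -> V) (A : set R) :
  0 <= T -> {within `[0, T], continuous x} -> {within A, continuous (freeze T x)}.
Proof.
move=> T0 /within_continuousP H; apply/within_continuousP => t _ e e0.
have [|d d0 Hd] := H (Num.max 0 (Num.min t T)) _ e e0.
  by rewrite /= in_itv/= freeze_in.
exists d => // s _ ts; apply: Hd; first by rewrite /= in_itv/= freeze_in.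
exact: le_lt_trans (clamp_lipschitz _ _ _ _) ts.
Qed.

End WithinContinuity.

Section GeometricConvergence.
Context {R : realType}.

Lemma geometric_small (C e : R) : 0 < e -> exists k : nat, C / 2 ^+ k <= e.
Proof.
move=> e0; exists (Num.bound (C / e)).
rewrite ler_pdivrMr ?exprn_gt0// mulrC -ler_pdivrMr//.
exact/ltW/upper_nthrootP.
Qed.

(** With w_k = 2 C / 2 ^ k, the sequence a_k - w_k increases and a_k + w_k
    decreases, so the limit is the supremum of the former. *)
Lemma geometric_cvg (a : nat -> R) (C : R) : 0 <= C ->
  (forall k, `|a k.+1 - a k| <= C / 2 ^+ k) ->
  exists l, forall k, `|a k - l| <= 2 * C / 2 ^+ k.
Proof.
move=> C0 H.
pose w k : R := 2 * C / 2 ^+ k.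
have wS k : w k - w k.+1 = C / 2 ^+ k.
  by rewrite /w exprS; field; rewrite expf_neq0.
have w0 k : 0 <= w k by rewrite /w !mulr_ge0// invr_ge0 exprn_ge0.
have lo k : a k - w k <= a k.+1 - w k.+1.
  by have := H k; have := wS k; rewrite ler_norml => <- /andP[]; lra.
have hi k : a k.+1 + w k.+1 <= a k + w k.
  by have := H k; have := wS k; rewrite ler_norml => <- /andP[]; lra.
have lom j k : (j <= k)%N -> a j - w j <= a k - w k.
  by move=> /subnK <-; elim: (k - j)%N => [|i IH]//; exact: le_trans IH (lo _).
have him j k : (j <= k)%N -> a k + w k <= a j + w j.
  by move=> /subnK <-; elim: (k - j)%N => [|i IH]//; exact: le_trans (hi _) IH.
have lohi j k : a j - w j <= a k + w k.
  apply: (le_trans (lom _ _ (leq_maxl j k))).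
  by apply: le_trans (him _ _ (leq_maxr j k)); have := w0 (maxn j k); lra.
exists (sup (range (fun k => a k - w k))) => k; rewrite -/(w k) ler_norml.
have h1 : a k - w k <= sup (range (fun k => a k - w k)).
  by apply: ub_le_sup; [exists (a k + w k) => _ [j _ <-]|exists k].
have h2 : sup (range (fun k => a k - w k)) <= a k + w k.
  by apply: ge_sup; [exists (a 0 - w 0), 0|move=> _ [j _ <-]].
by apply/andP; split; lra.
Qed.

End GeometricConvergence.

(** * Integral equations with a Lipschitz right-hand side *)

Section ODE.
Context {R : realType}.
Notation mu := (@lebesgue_measure R).

Lemma Rintegral_expR (c t : R) : 0 < c -> 0 <= t ->
  \int[mu]_(s in `[0, t]) (c * expR (c * s)) = expR (c * t) - 1.
Proof.
move=> c0; rewrite le_eqVlt => /predU1P[<-|t0].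
  by rewrite set_itv1 Rintegral_set1 mulr0 expR0 subrr.
have cF : continuous (fun s : R => expR (c * s)).
  move=> s; apply: continuous_comp; last exact: continuous_expR.
  exact: mulrl_continuous.
rewrite /Rintegral (@continuous_FTC2 _ _ (fun s => expR (c * s))) //.
- by rewrite /= mulr0 expR0.
- apply: continuous_subspaceT => s.
  by apply: cvgM; [exact: cvg_cst|exact: cF].
- split=> [s _||]; first by [].
  + exact/cvg_at_right_filter/cF.
  + exact/cvg_at_left_filter/cF.
- move=> s _; rewrite derive1_comp// derive1E.
  have /funeqP -> := @derive_expR R.
  by rewrite derive1Ml// derive1_id mulr1 mulrC.
Qed.

(** For the weight e^(2 K s) the integral operator of a K-Lipschitz equation
    contracts by the factor 1/2 on any interval, since K e^(2 K s) integrates to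
    less than e^(2 K t) / 2. *)
Lemma weighted_integral_le (K M t : R) (h : R -> R) :
  0 < K -> 0 <= M -> 0 <= t -> mu.-integrable `[0, t] (EFin \o h) ->
  (forall s, 0 <= s <= t -> `|h s| <= K * (M * expR (2 * K * s))) ->
  `|\int[mu]_(s in `[0, t]) h s| <= M / 2 * expR (2 * K * t).
Proof.
move=> K0 M0 t0 ih hle.
have K20 : 0 < 2 * K by rewrite mulr_gt0.
have ie : mu.-integrable `[0, t] (EFin \o (fun s => 2 * K * expR (2 * K * s))).
  apply: continuous_compact_integrable; first exact: segment_compact.
  apply: continuous_subspaceT => s.
  apply: cvgM; first exact: cvg_cst.
  apply: continuous_comp; last exact: continuous_expR.
  exact: mulrl_continuous.
have iM : mu.-integrable `[0, t]
    (EFin \o (fun s => (M / 2) * (2 * K * expR (2 * K * s)))).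
  exact: (integrableZl _ (M / 2) ie).
apply: le_trans (le_normr_Rintegral _ ih) _ => //.
apply: (@le_trans _ _ (\int[mu]_(s in `[0, t]) (M / 2 * (2 * K * expR (2 * K * s))))).
  apply: le_Rintegral => //.
    exact: (integrable_abse ih).
  move=> s /=; rewrite in_itv/= => /hle /le_trans; apply.
  by rewrite le_eqVlt; apply/orP; left; apply/eqP; field.
rewrite RintegralZl// Rintegral_expR// ler_wpM2l ?divr_ge0//.
by rewrite lerBlDr lerDl.
Qed.

Section Solutions.
Variable m : nat.
Implicit Types (g : R -> 'cV[R]_m -> 'cV[R]_m) (x y z : R -> 'cV[R]_m).

Lemma ode_solution_subset g (x0 : 'cV[R]_m) (A B : set R) x :
  A `<=` B -> ode_solution g x0 B x -> ode_solution g x0 A x.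
Proof.
move=> AB [cx ix]; split; first exact: within_continuous_subset cx.
by move=> t /AB; exact: ix.
Qed.

Lemma ode_solution_congr g g' (x0 : 'cV[R]_m) (A : set R) x y :
  (forall t, A t -> `[0, t] `<=` A) ->
  {in A, x =1 y} -> (forall t, A t -> g t (x t) = g' t (y t)) ->
  ode_solution g x0 A x -> ode_solution g' x0 A y.
Proof.
move=> AT xy gg [cx ix]; split.
  apply/within_continuousP => t At e e0.
  have /within_continuousP /(_ t At e e0)[d d0 Hd] := cx.
  by exists d => // s As ts; rewrite -!xy ?inE//; exact: Hd.
move=> t At k; have [i1 e1] := ix t At k.
have E s : s \in `[0, t]%classic -> g s (x s) k 0 = g' s (y s) k 0.
  by move=> /set_mem st; rewrite gg//; exact: AT st.
split.
  by apply: (eq_integrable _ _ _ _ i1) => // s st; rewrite E.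
by rewrite -xy ?inE// e1; congr (_ + _); apply: eq_Rintegral => s /E.
Qed.

Lemma ode_solution0 g (x0 : 'cV[R]_m) (A : set R) x : A 0 -> ode_solution g x0 A x -> x 0 = x0.
Proof.
move=> A0 [_ H]; apply/matrixP => k j; rewrite ord1.
by have [_ ->] := H 0 A0 k; rewrite set_itv1 Rintegral_set1 addr0.
Qed.

Lemma ode_solution_shift g (x0 : 'cV[R]_m) x (a : R) : 0 <= a ->
  ode_solution g x0 `[0, +oo[ x ->
  ode_solution (fun s => g (s + a)) (x a) `[0, +oo[ (fun s => x (s + a)).
Proof.
move=> a0 [cx ix]; split.
  apply/within_continuousP => t; rewrite /= in_itv/= andbT => t0 e e0.
  have /within_continuousP /(_ (t + a)) := cx.
  rewrite /= in_itv/= andbT addr_ge0// => /(_ isT e e0)[d d0 Hd].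
  exists d => // s; rewrite /= in_itv/= andbT => s0 ts; apply: Hd.
    by rewrite /= in_itv/= andbT addr_ge0.
  by rewrite opprD addrACA subrr addr0.
move=> t; rewrite /= in_itv/= andbT => t0 k.
have [ia ea] : mu.-integrable `[0, a] (fun s => (g s (x s) k 0)%:E) /\
     x a k 0 = x0 k 0 + \int[mu]_(s in `[0, a]) g s (x s) k 0.
  by apply: ix; rewrite /= in_itv/= a0.
have [it et] : mu.-integrable `[0, t + a] (fun s => (g s (x s) k 0)%:E) /\
     x (t + a) k 0 = x0 k 0 + \int[mu]_(s in `[0, t + a]) g s (x s) k 0.
  by apply: ix; rewrite /= in_itv/= addr_ge0.
have ita : mu.-integrable `[a, t + a] (EFin \o fun s => g s (x s) k 0).
  apply: integrableS it => //; apply: subset_itvr; by rewrite bnd_simp.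
have ita' : mu.-integrable `]a, t + a] (EFin \o fun s => g s (x s) k 0).
  apply: integrableS ita => //; apply: subset_itvr; by rewrite bnd_simp.
have [i1 e1] := Rintegral_shift ita; split; first exact: i1.
rewrite (e1) et ea -addrA; congr (_ + _).
rewrite -(Rintegral_itv_obnd_cbnd ita') -(Rintegral_itvB it) ?bnd_simp ?lerDr//.
by rewrite addrC subrK.
Qed.

(** One application of the integral operator halves the weighted distance; this
    single estimate gives both uniqueness and convergence of the iterates. *)
Lemma weighted_picard_step g (K M T : R) x y t :
  0 < K -> 0 <= M -> 0 <= t <= T ->
  (forall k, mu.-integrable `[0, t] (fun s => (g s (x s) k 0)%:E)) ->
  (forall k, mu.-integrable `[0, t] (fun s => (g s (y s) k 0)%:E)) ->
  (forall s, 0 <= s <= T -> `|g s (x s) - g s (y s)| <= K * `|x s - y s|) ->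
  (forall s, 0 <= s <= T -> `|x s - y s| <= M * expR (2 * K * s)) ->
  forall k, `|\int[mu]_(s in `[0, t]) g s (x s) k 0 -
     \int[mu]_(s in `[0, t]) g s (y s) k 0| <= M / 2 * expR (2 * K * t).
Proof.
move=> K0 M0 /andP[t0 tT] ix iy gl xy k.
rewrite -RintegralB//; [|exact: ix|exact: iy].
apply: weighted_integral_le => //.
  exact: (integrableB _ (ix k) (iy k)).
move=> s /andP[s0 st]; have sT : 0 <= s <= T by rewrite s0 (le_trans st).
have := mx_entry_le (g s (x s) - g s (y s)) k 0; rewrite !mxE => /le_trans; apply.
apply: le_trans (gl _ sT) _; rewrite ler_wpM2l ?xy// ltW//.
Qed.

(** The weighted distance of two solutions on [0, T] is at most half of itself:
    iterating, it is below D / 2 ^ n for all n. *)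
Lemma ode_solution_unique g (x0 : 'cV[R]_m) (b : R) y z :
  ode_solution g x0 `[0, b[ y -> ode_solution g x0 `[0, b[ z ->
  (forall T, T < b -> exists K, forall s, 0 <= s <= T ->
     `|g s (y s) - g s (z s)| <= K * `|y s - z s|) ->
  {in `[0, b[, y =1 z}.
Proof.
move=> [cy iy] [cz iz] H T; rewrite in_itv/= => /andP[T0 Tb].
have [K0 HK0] := H T Tb.
pose K := Num.max K0 1.
have K1 : 0 < K by rewrite /K lt_max ltr01 orbT.
have HK s : 0 <= s <= T -> `|g s (y s) - g s (z s)| <= K * `|y s - z s|.
  by move=> /HK0 /le_trans; apply; rewrite ler_wpM2r// /K le_max lexx.
have sub : `[0, T] `<=` `[0, b[ by apply: subset_itvl; rewrite bnd_simp.
have [D D0 HD] := within_continuous_bounded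
  (within_continuousB (within_continuous_subset sub cy) (within_continuous_subset sub cz)).
have step n : forall t, 0 <= t <= T -> `|y t - z t| <= D / 2 ^+ n * expR (2 * K * t).
  elim: n => [|n IH] t tT.
    rewrite expr0 divr1; apply: le_trans (HD t tT) _; rewrite ler_peMr ?(ltW D0)//.
    have /andP[t0 _] := tT.
    by rewrite -expR0 ler_expR !mulr_ge0// ltW.
  have DM : 0 <= D / 2 ^+ n by rewrite divr_ge0 ?exprn_ge0 ?ltW.
  apply: mx_norm_le => [|k j].
    by rewrite mulr_ge0 ?expR_ge0// divr_ge0 ?exprn_ge0 ?ltW.
  have tA : `[0, b[%classic t.
    by rewrite /= in_itv/=; have /andP[-> tT'] := tT; exact: le_lt_trans Tb.
  rewrite !mxE ord1; have [iyt ->] := iy t tA k; have [izt ->] := iz t tA k.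
  rewrite opprD addrACA subrr add0r exprSr invfM mulrA.
  apply: (@weighted_picard_step g K _ T) => //.
    by move=> k'; have [] := iy t tA k'.
  by move=> k'; have [] := iz t tA k'.
apply/eqP; rewrite -subr_eq0 -normr_le0; apply/ler_addgt0Pr => e e0; rewrite add0r.
have [n Hn] := geometric_small (D * expR (2 * K * T)) e0.
have TT : 0 <= T <= T by rewrite T0 lexx.
by apply: le_trans (step n T TT) _; rewrite mulrAC.
Qed.

Section Picard.
Variables (g : R -> 'cV[R]_m -> 'cV[R]_m) (x0 : 'cV[R]_m) (K : R).
Hypothesis K0 : 0 < K.
Hypothesis gmeas : forall T x, 0 <= T -> {within `[0, T], continuous x} ->
  forall k, measurable_fun `[0, T] (fun s => g s (x s) k 0).
Hypothesis glip : forall s (v w : 'cV[R]_m), `|g s v - g s w| <= K * `|v - w|.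
Hypothesis gint : forall T k, 0 <= T -> mu.-integrable `[0, T] (fun s => (g s 0 k 0)%:E).

Let segment_continuous x := forall T, 0 <= T -> {within `[0, T], continuous x}.

Lemma picard_integrable x T k : 0 <= T -> {within `[0, T], continuous x} ->
  mu.-integrable `[0, T] (fun s => (g s (x s) k 0)%:E).
Proof.
move=> T0 cx; have [B B0 HB] := within_continuous_bounded cx.
have ic : mu.-integrable `[0, T] (EFin \o (fun=> K * B)).
  apply: continuous_compact_integrable; first exact: segment_compact.
  by apply: continuous_subspaceT => s; exact: cvg_cst.
have ib : mu.-integrable `[0, T] (EFin \o fun s => `|g s 0 k 0| + K * B).
  by apply: (integrableD _ (integrable_abse (gint k T0)) ic).
apply: (le_integrable _ _ _ ib) => //.
  by apply/measurable_EFinP; exact: gmeas.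
move=> s /=; rewrite in_itv/= => sT; rewrite lee_fin.
rewrite [leRHS]ger0_norm; last by rewrite addr_ge0// mulr_ge0// ltW.
have := mx_entry_le (g s (x s) - g s 0) k 0; rewrite !mxE => h1.
have := glip s (x s) 0; rewrite subr0 => h2.
have h3 : K * `|x s| <= K * B by rewrite ler_wpM2l ?HB// ltW.
have := ler_normD (g s (x s) k 0 - g s 0 k 0) (g s 0 k 0); rewrite subrK.
lra.
Qed.

Definition picard x : R -> 'cV[R]_m :=
  fun t => \col_k (x0 k 0 + \int[mu]_(s in `[0, t]) g s (x s) k 0).

Lemma picard_continuous x : segment_continuous x -> segment_continuous (picard x).
Proof.
move=> cx T T0; apply: within_continuous_cV => k.
have iT := picard_integrable k T0 (cx _ T0).
have := parameterized_integral_continuous T0 iT => /within_continuousP H.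
apply/within_continuousP => t tT e e0; have [d d0 Hd] := H t tT e e0.
exists d => // s sT ts; have := Hd s sT ts; rewrite !mxE.
by rewrite opprD addrACA subrr add0r.
Qed.

(** The iterates are defined on all of [0, +oo[ at once.  On [0, T] their
    successive differences are at most I0(T) e^(2 K T) / 2 ^ k, where I0(T)
    bounds the first difference, so they converge uniformly there. *)
Theorem picard_existence : exists x, ode_solution g x0 `[0, +oo[ x.
Proof.
pose X k := iter k picard (cst x0).
have cX k : segment_continuous (X k).
  elim: k => [|k IH]; last exact: picard_continuous.
  by move=> T _; apply: continuous_subspaceT => s; exact: cvg_cst.
pose I0 t := \sum_k (\int[mu]_(s in `[0, t]) `|g s x0 k 0|).
have I00 t : 0 <= I0 t by apply: sumr_ge0 => k _; exact: Rintegral_ge0.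
have I0m t T : 0 <= t -> t <= T -> I0 t <= I0 T.
  move=> t0 tT; apply: ler_sum => k _.
  have iT := @picard_integrable (cst x0) T k (le_trans t0 tT) (cX 0%N _ (le_trans t0 tT)).
  have := @Rintegral_itvB R (fun s => `|g s x0 k 0|) (BLeft 0) (BRight T) t.
  have iT' : mu.-integrable `[0, T] (EFin \o fun s => `|g s x0 k 0|).
    exact: (integrable_abse iT).
  move=> /(_ iT'); rewrite !bnd_simp => /(_ t0 tT) E.
  by rewrite -subr_ge0 E; exact: Rintegral_ge0.
have step k : forall T t, 0 <= t <= T ->
    `|X k.+1 t - X k t| <= I0 T / 2 ^+ k * expR (2 * K * t).
  elim: k => [|k IH] T t /andP[t0 tT].
    rewrite expr0 divr1; apply: (@le_trans _ _ (I0 T)); last first.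
      rewrite ler_peMr// -expR0 ler_expR !mulr_ge0// ltW//.
    apply: mx_norm_le => // k j; rewrite !mxE ord1 addrAC subrr add0r.
    apply: le_trans (I0m _ _ t0 tT).
    have it := @picard_integrable (cst x0) t k t0 (cX 0%N _ t0).
    apply: le_trans (le_normr_Rintegral _ it) _ => //.
    rewrite /I0 (bigD1 k)//= lerDl; apply: sumr_ge0 => ? _; exact: Rintegral_ge0.
  apply: mx_norm_le => [|i j].
    by rewrite mulr_ge0 ?expR_ge0// divr_ge0 ?exprn_ge0.
  rewrite !mxE opprD addrACA subrr add0r exprSr invfM mulrA.
  apply: (@weighted_picard_step g K _ T) => //.
  - by rewrite divr_ge0 ?exprn_ge0.
  - by rewrite t0.
  - by move=> k'; apply: picard_integrable => //; exact: (cX k.+1).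
  - by move=> k'; apply: picard_integrable => //; exact: (cX k).
  - by move=> s /IH.
pose C T := I0 T * expR (2 * K * T).
have C0 T : 0 <= C T by rewrite mulr_ge0 ?expR_ge0.
have stepC T t k : 0 <= t <= T -> `|X k.+1 t - X k t| <= C T / 2 ^+ k.
  move=> tT; apply: le_trans (step k T t tT) _; rewrite /C mulrAC.
  rewrite ler_wpM2r ?invr_ge0 ?exprn_ge0// ler_wpM2l// ler_expR ler_wpM2l//.
    by rewrite mulr_ge0// ltW.
  by case/andP: tT.
have lim t i : exists l, 0 <= t -> forall T, t <= T ->
    forall k, `|X k t i 0 - l| <= 2 * C T / 2 ^+ k.
  have [t0|t0] := leP 0 t; last by exists 0.
  have [|l Hl] := @geometric_cvg _ (fun k => X k t i 0) _ (C0 t).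
    move=> k; apply: le_trans (stepC t t k _); last by rewrite t0 lexx.
    by have := mx_entry_le (X k.+1 t - X k t) i 0; rewrite !mxE.
  exists l => _ T tT k.
  apply: le_trans (Hl k) _; rewrite ler_wpM2r ?invr_ge0 ?exprn_ge0// ler_wpM2l//.
  rewrite /C ler_pM ?expR_ge0 ?I0m// ler_expR ler_wpM2l//.
  by rewrite mulr_ge0// ltW.
have /choice[x xP] : forall t, exists x : 'cV[R]_m, 0 <= t -> forall T, t <= T ->
    forall k, `|X k t - x| <= 2 * C T / 2 ^+ k.
  move=> t; have /choice[l lP] := lim t; exists (\col_i l i) => t0 T tT k.
  apply: mx_norm_le => [|i j]; first by rewrite !mulr_ge0 ?invr_ge0 ?exprn_ge0.
  by rewrite !mxE ord1; exact: lP.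
have cx : segment_continuous x.
  move=> T T0; apply/within_continuousP => t tT e e0.
  have e3 : 0 < e / 3 by rewrite divr_gt0.
  have [k Hk] := geometric_small (2 * C T) e3.
  have /within_continuousP /(_ t tT _ e3)[d d0 Hd] := cX k _ T0.
  exists d => // s sT ts.
  have := Hd s sT ts.
  have apx r : `[0, T]%classic r -> `|X k r - x r| <= e / 3.
    rewrite /= in_itv/= => /andP[r0 rT].
    exact: le_trans (xP r r0 T rT k) Hk.
  have := apx t tT; have := apx s sT.
  have := ler_distD (X k t) (x t) (x s); have := ler_distD (X k s) (X k t) (x s).
  rewrite [`|x t - X k t|]distrC; lra.
exists x; split.
  apply: within_continuous_exhaust.
  - by move=> t /=; rewrite in_itv/= andbT.
  - move=> t /=; rewrite in_itv/= andbT => t0; exists (t + 1); first by rewrite ltrDl.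
    by move=> s /=; rewrite !in_itv/= andbT => /andP[].
  - by move=> t /=; rewrite in_itv/= andbT => t0; exact: cx.
move=> t /=; rewrite in_itv/= andbT => t0 i.
have ix := fun i => picard_integrable i t0 (cx t t0).
split; first exact: ix.
apply/eqP; rewrite -subr_eq0 -normr_le0; apply/ler_addgt0Pr => e e0; rewrite add0r.
have e2 : 0 < e / 2 by rewrite divr_gt0.
have [k Hk] := geometric_small (2 * C t + 2 * C t * expR (2 * K * t)) e2.
have tt : 0 <= t <= t by rewrite t0 lexx.
have h1 : `|X k.+1 t i 0 - x t i 0| <= 2 * C t / 2 ^+ k.
  have := mx_entry_le (X k.+1 t - x t) i 0; rewrite !mxE => /le_trans; apply.
  apply: le_trans (xP t t0 t (lexx t) k.+1) _.
  rewrite ler_wpM2l ?mulr_ge0// lef_pV2 ?posrE ?exprn_gt0//.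
  by rewrite exprS ler_peMl ?exprn_ge0// ler1n.
have h2 : `|X k.+1 t i 0 - (x0 i 0 + \int[mu]_(s in `[0, t]) g s (x s) i 0)| <=
    2 * C t / 2 ^+ k / 2 * expR (2 * K * t).
  rewrite [X k.+1 t]/= mxE opprD addrACA subrr add0r.
  apply: (@weighted_picard_step g K _ t) => //.
  - by rewrite !mulr_ge0 ?invr_ge0 ?exprn_ge0.
  - by move=> k'; apply: picard_integrable => //; exact: cX.
  - move=> s /andP[s0 st]; apply: le_trans (xP s s0 t st k) _.
    rewrite ler_peMr ?mulr_ge0 ?invr_ge0 ?exprn_ge0//.
    by rewrite -expR0 ler_expR !mulr_ge0// ltW.
have h3 : 2 * C t / 2 ^+ k / 2 * expR (2 * K * t) <=
    2 * C t / 2 ^+ k * expR (2 * K * t).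
  rewrite ler_wpM2r ?expR_ge0// ler_pdivrMr// ler_peMr ?ler1n//.
  by rewrite !mulr_ge0 ?invr_ge0 ?exprn_ge0.
have := ler_distD (X k.+1 t i 0) (x t i 0) (x0 i 0 + \int[mu]_(s in `[0, t]) g s (x s) i 0).
rewrite [`|x t i 0 - X _ _ _ _|]distrC => /le_trans; apply.
move: Hk; rewrite mulrDl mulrAC => Hk.
have := lerD h1 (le_trans h2 h3); lra.
Qed.

End Picard.
End Solutions.
End ODE.

(** * Essentially bounded inputs and subsystem estimates *)

Section Blocks.
Context {R : realType} {n : nat} {N : 'I_n -> nat}.
Implicit Types x : 'cV[R]_(\sum_j N j).

Lemma submxcol_norm_le x i : `|submxcol x i| <= `|x|.
Proof. by apply: mx_norm_le => // k j; rewrite mxE; exact: mx_entry_le. Qed.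

Lemma norm_le_sum_submxcol x : `|x| <= \sum_i `|submxcol x i|.
Proof.
apply: mx_norm_le => [|k j]; first exact: sumr_ge0.
have -> : x k j = submxcol x (tagnat.sig1 k) (tagnat.sig2 k) j.
  by rewrite !mxE tagnat.sig2K.
rewrite (bigD1 (tagnat.sig1 k))//=; apply: ler_wpDr; first exact: sumr_ge0.
exact: mx_entry_le.
Qed.

End Blocks.

Section EssentialSupremum.
Context {R : realType}.
Notation mu := (@lebesgue_measure R).
Variable nrm : forall m, 'cV[R]_m -> R.
Hypothesis nrmN : forall m, is_norm (nrm (m := m)).
Arguments nrm {m}.

Lemma lebesgue_measure_setT_gt0 : (0 < mu setT)%E.
Proof.
apply: (@lt_le_trans _ _ (mu `[0, 1]%classic)); last by rewrite le_measure ?inE.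
by rewrite lebesgue_measure_itv/= lte_fin ltr01 oppr0 adde0 lte_fin.
Qed.

Lemma linf_norm_ge0 m (v : R -> 'cV[R]_m) : (0 <= linf_norm (@nrm) v)%E.
Proof.
apply: ess_sup_ger; first exact: lebesgue_measure_setT_gt0.
by move=> t; rewrite lee_fin is_norm_ge0.
Qed.

Lemma linf_norm_le m (v : R -> 'cV[R]_m) (M : R) : 0 <= M ->
  (forall t, 0 <= t -> nrm (v t) <= M) -> (linf_norm (@nrm) v <= M%:E)%E.
Proof.
move=> M0 H; apply: ess_sup_ler => t; rewrite lee_fin /patch.
case: ifPn => [|_]; last by rewrite is_norm0.
by rewrite inE/= in_itv/= andbT; exact: H.
Qed.

Lemma fine_linf_norm_ge0 m (v : R -> 'cV[R]_m) : 0 <= fine (linf_norm (@nrm) v).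
Proof. exact/fine_ge0/linf_norm_ge0. Qed.

Lemma fine_linf_norm_le m (v : R -> 'cV[R]_m) (M : R) :
  (linf_norm (@nrm) v <= M%:E)%E -> fine (linf_norm (@nrm) v) <= M.
Proof.
move=> H; rewrite -lee_fin fineK// ge0_fin_numE ?linf_norm_ge0//.
exact: le_lt_trans H (ltry _).
Qed.

Lemma ess_bounded_ae m (u : R -> 'cV[R]_m) : ess_bounded (@nrm) u ->
  {ae mu, forall t, 0 <= t -> nrm (u t) <= fine (linf_norm (@nrm) u)}.
Proof.
move=> [_ ub].
have uf : linf_norm (@nrm) u \is a fin_num by rewrite ge0_fin_numE ?linf_norm_ge0.
apply: filterS (ess_sup_ge mu (fun t => (nrm (patch (cst 0) `[0, +oo[ u t))%:E)) => t.
rewrite -/(linf_norm (@nrm) u) -(fineK uf) lee_fin => H t0.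
by move: H; rewrite patchT// inE/= in_itv/= t0.
Qed.

Lemma ess_bounded_shift m (u : R -> 'cV[R]_m) a : 0 <= a -> ess_bounded (@nrm) u ->
  ess_bounded (@nrm) (fun s => u (s + a)) /\
  fine (linf_norm (@nrm) (fun s => u (s + a))) <= fine (linf_norm (@nrm) u).
Proof.
move=> a0 ub; have [um _] := ub.
have L : (linf_norm (@nrm) (fun s => u (s + a)%R) <= (fine (linf_norm (@nrm) u))%:E)%E.
  apply/ess_supP.
  have := ae_shift a (ess_bounded_ae ub).
  apply: (@filterS _ (almost_everywhere mu)) => t H; rewrite lee_fin /patch.
  case: ifPn => [|_]; last by rewrite is_norm0// fine_linf_norm_ge0.
  by rewrite inE/= in_itv/= andbT => t0; apply: H; rewrite addr_ge0.
split; last exact: fine_linf_norm_le.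
split; last exact: le_lt_trans L (ltry _).
move=> k.
have mA : measurable (`[0, +oo[%classic : set R) by [].
have sA : (fun s : R => s + a) @` `[0, +oo[ `<=` `[0, +oo[.
  by move=> _ [s /= + <-]; rewrite !in_itv/= !andbT => s0; rewrite addr_ge0.
have mS : measurable_fun (`[0, +oo[%classic : set R) (fun s : R => s + a).
  by apply: measurable_funTS; exact: measurable_shift.
exact: (measurable_comp mA sA (um k) mS).
Qed.

Lemma freeze_ess_bounded m (T : R) (x : R -> 'cV[R]_m) :
  0 <= T -> {within `[0, T], continuous x} -> ess_bounded (@nrm) (freeze T x).
Proof.
move=> T0 cx; split.
  move=> k; apply: within_continuous_measurable => //.
  exact/within_continuous_coord/freeze_continuous.
have [M M0 HM] := within_continuous_bounded cx.
have [C C0 HC] := is_norm_le_mx_norm (nrmN m).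
apply: le_lt_trans (ltry (C * M)); apply: linf_norm_le => [|t t0].
  by rewrite mulr_ge0// ltW.
by apply: le_trans (HC _) _; rewrite ler_wpM2l ?(ltW C0)// HM// freeze_in.
Qed.

End EssentialSupremum.

Section FiniteHorizon.
Context {R : realType}.
Notation mu := (@lebesgue_measure R).
Variable nrm : forall m, 'cV[R]_m -> R.
Hypothesis nrmN : forall m, is_norm (nrm (m := m)).
Variables (n l : nat) (N : 'I_n -> nat).
Variable f : forall i, 'cV[R]_(\sum_j N j) -> 'cV[R]_l -> 'cV[R]_(N i).
Arguments nrm {m}.

(** The blocks of a solution solve any equation whose right-hand side agrees with
    f_i along that solution; the subsystem with frozen inputs is of this kind. *)
Lemma ode_solution_block (u : R -> 'cV[R]_l) (x0 : 'cV[R]_(\sum_j N j)) (A : set R)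
    (x : R -> 'cV[R]_(\sum_j N j)) i (g : R -> 'cV[R]_(N i) -> 'cV[R]_(N i)) :
  (forall t, A t -> `[0, t] `<=` A) ->
  (forall s, A s -> g s (submxcol (x s) i) = f i (x s) (u s)) ->
  ode_solution (fun t y => interconnection f y (u t)) x0 A x ->
  ode_solution g (submxcol x0 i) A (fun s => submxcol (x s) i).
Proof.
move=> AT gf [cx ix]; split.
  apply/within_continuousP => t At e e0.
  have /within_continuousP /(_ t At e e0)[d d0 Hd] := cx.
  exists d => // s As ts; apply: le_trans (Hd s As ts).
  by rewrite -submxcolB; exact: submxcol_norm_le.
move=> t At k; have [i1 e1] := ix t At (tagnat.Rank i k).
have E s : s \in `[0, t]%classic ->
    interconnection f (x s) (u s) (tagnat.Rank i k) 0 = g s (submxcol (x s) i) k 0.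
  move=> /set_mem st; rewrite gf; last exact: AT st.
  have /matrixP /(_ k 0) := mxcolK (fun i => f i (x s) (u s)) i.
  by rewrite mxE.
split.
  by apply: (eq_integrable _ _ _ _ i1) => // s st; rewrite E.
by rewrite !mxE e1; congr (_ + _); apply: eq_Rintegral => s /E.
Qed.

(** The subsystem estimate concerns inputs and solutions on the whole half-line,
    whereas x is only known on [0, b[.  Between t and b a time t' is chosen, the
    blocks of x are frozen after t' and used as inputs of the i-th subsystem; its
    global solution z agrees with x_i before t' by uniqueness, and the estimate
    for z at time t only involves the inputs on [0, t]. *)
Lemma subsystem_estimate (beta : R -> R -> R) (gain : 'I_n -> R -> R) (gamma : R -> R)
    i (u : R -> 'cV[R]_l) x0 (x : R -> 'cV[R]_(\sum_j N j)) (b t : R) (M : 'I_n -> R) :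
  subsystem_ISS (@nrm) f i beta gain gamma ->
  (forall j, modulus (gain j)) ->
  ess_bounded (@nrm) u ->
  ode_solution (fun t y => interconnection f y (u t)) x0 `[0, b[ x ->
  0 <= t < b ->
  (forall j s, 0 <= s <= t -> nrm (submxcol (x s) j) <= M j) ->
  nrm (submxcol (x t) i) <= beta (nrm (submxcol x0 i)) t
     + \sum_j gain j (M j) + gamma (fine (linf_norm (@nrm) u)).
Proof.
move=> [exS estS] gainM ub solx /andP[t0 tb] HM.
pose t' := (t + b) / 2.
have tt' : t < t' by rewrite /t'; lra.
have t'b : t' < b by rewrite /t'; lra.
have t'0 : 0 <= t' := le_trans t0 (ltW tt').
have sub1 : `[0, t'[ `<=` `[0, b[ by apply: subset_itvl; rewrite bnd_simp ltW.
have sub2 : `[0, t'] `<=` `[0, b[ by apply: subset_itvl; rewrite bnd_simp.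
have down (c : R) s : `[0, c[%classic s -> `[0, s] `<=` `[0, c[.
  by rewrite /= in_itv/= => /andP[_ sc]; apply: subset_itvl; rewrite bnd_simp.
have M0 j : 0 <= M j.
  by apply: le_trans (HM j 0 _); rewrite ?is_norm_ge0// lexx.
pose X j := freeze t' (fun s => submxcol (x s) j).
have bX j : ess_bounded (@nrm) (X j).
  apply: freeze_ess_bounded => //.
  have [cx _] := solx; have /within_continuousP cx' := within_continuous_subset sub2 cx.
  apply/within_continuousP => s st e e0; have [d d0 Hd] := cx' s st e e0.
  exists d => // r rt sr; apply: le_trans (Hd r rt sr).
  by rewrite -submxcolB; exact: submxcol_norm_le.
have [z [solz uniz]] := exS X u (fun j _ => bX j) ub (submxcol x0 i).
have subE s (w : 'cV[R]_(\sum_j N j)) : (forall j, j != i -> X j s = submxcol w j) ->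
    subsystem f X u s (submxcol w i) = f i w (u s).
  move=> H; rewrite /subsystem; congr (f i _ _).
  rewrite -[RHS]submxcolK; apply: eq_mxcol => j.
  case: dfwithP => [|j' ij']; first by [].
  by apply: H; rewrite eq_sym.
have xz : {in `[0, t'[, (fun s => submxcol (x s) i) =1 z}.
  apply: uniz; apply: (@ode_solution_block u _ _ x) => //.
  - exact: down.
  - move=> s; rewrite /= in_itv/= => /andP[s0 st']; apply: subE => j _.
    by rewrite /X freeze_id// s0 ltW.
  - exact: ode_solution_subset solx.
pose Y := dfwith X i z.
have YE s : subsystem (i := i) f Y u s = subsystem (i := i) f X u s.
  apply/funext => w; rewrite /subsystem.
  suff E j : dfwith (fun j => Y j s) i w j = dfwith (fun j => X j s) i w j.
    by rewrite (eq_mxcol E).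
  case: (eqVneq i j) => [<-|ij]; first by rewrite !dfwithin.
  by rewrite !dfwithout// /Y dfwithout.
have Yi : Y i = z by rewrite /Y dfwithin.
have z0 : z 0 = submxcol x0 i.
  by apply: ode_solution0 solz; rewrite /= in_itv/= lexx.
have tin : t \in `[0, t'[ by rewrite in_itv/= t0.
have Yx j s : 0 <= s <= t -> Y j s = submxcol (x s) j.
  move=> /andP[s0 st].
  rewrite /Y; case: dfwithP => [|k ik].
    by rewrite -xz// in_itv/= s0 (le_lt_trans st).
  by rewrite /X freeze_id// s0 (le_trans st)// ltW.
have := estS Y u _ ub _ t t0.
rewrite Yi z0 -xz//; move=> /(_ _ _)/wrap[].
- by move=> j ji; rewrite /Y dfwithout// eq_sym.
- rewrite (_ : subsystem (i := i) f Y u = subsystem (i := i) f X u)//.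
  by apply/funext => s; exact: YE.
move=> /le_trans; apply; rewrite lerD2r lerD2l; apply: ler_sum => j _.
have [_ gm _] := gainM j; apply: gm; first exact: fine_linf_norm_ge0.
apply: fine_linf_norm_le => //; apply: linf_norm_le => // s s0.
rewrite /trunc /patch; case: ifPn => [|_]; last by rewrite is_norm0.
by rewrite inE/= in_itv/= => st; rewrite Yx//; exact: HM.
Qed.

End FiniteHorizon.

(** * Attractivity and class KL bounds for families of trajectories *)

Section Attractivity.
Context {R : realType} {n : nat}.
Variable gain : 'I_n -> 'I_n -> R -> R.
Hypothesis gainK : forall i j, class_K_or_zero (gain i j).

Let gainM i j : modulus (gain i j).
Proof. exact/class_K_or_zero_modulus/gainK. Qed.

(** Right continuity suffices below, since the suprema W_j decrease to their
    limits. *)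
Lemma class_K_or_zero_right_continuous (g : R -> R) s e :
  class_K_or_zero g -> 0 <= s -> 0 < e ->
  exists2 d, 0 < d & forall t, s <= t <= s + d -> g t <= g s + e.
Proof.
move=> [[_ /within_continuousP gc _]|g0] s0 e0; last first.
  exists 1 => // t /andP[st _].
  by rewrite (g0 t (le_trans s0 st)) (g0 s s0) add0r; exact: ltW.
have [|d d0 Hd] := gc s _ e e0; first by rewrite /= in_itv/= s0.
exists (d / 2); first by rewrite divr_gt0.
move=> t /andP[st td]; have : `|g s - g t| <= e.
  apply: Hd; first by rewrite /= in_itv/= andbT; exact: le_trans st.
  by rewrite distrC ger0_norm ?subr_ge0//; lra.
by rewrite ler_norml => /andP[]; lra.
Qed.

Variables (P : Type) (y : P -> 'I_n -> R -> R) (b : 'I_n -> R -> R) (B c : R).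
Hypothesis y_le : forall p i t, 0 <= t -> y p i t <= B.
Hypothesis b0 : forall i e, 0 < e -> exists2 T, 0 <= T & forall t, T <= t -> b i t <= e.
Hypothesis y_est : forall p i s t (M : 'I_n -> R), 0 <= s -> 0 <= t ->
  (forall j r, s <= r -> y p j r <= M j) ->
  y p i (s + t) <= b i t + \sum_j gain i j (M j) + c.

(** The constant 0 keeps the supremum of a possibly empty family non-negative. *)
Let W j t := sup [set z | z = 0 \/ exists p s, t <= s /\ z = y p j s].

Let W_ub j t z : 0 <= t -> (z = 0 \/ exists p s, t <= s /\ z = y p j s) -> z <= W j t.
Proof.
move=> t0 H; apply: ub_le_sup => //; exists (Num.max 0 B) => w [->|[p [s [ts ->]]]].
  by rewrite le_max lexx.
by rewrite le_max y_le ?orbT// (le_trans t0).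
Qed.

Let W_le j t M : 0 <= M -> (forall p s, t <= s -> y p j s <= M) -> W j t <= M.
Proof.
move=> M0 H; apply: ge_sup; first by exists 0; left.
by move=> z [->|[p [s [ts ->]]]] //; exact: H.
Qed.

Let W_ge0 j t : 0 <= t -> 0 <= W j t.
Proof. by move=> t0; apply: W_ub => //; left. Qed.

Let y_W p j s t : 0 <= s -> s <= t -> y p j t <= W j s.
Proof. by move=> s0 st; apply: W_ub => //; right; exists p, t. Qed.

Let W_anti j s t : 0 <= s -> s <= t -> W j t <= W j s.
Proof.
move=> s0 st; apply: W_le; first exact: W_ge0.
by move=> p r tr; apply: y_W => //; exact: le_trans tr.
Qed.

Let Winf j := inf [set W j t | t in `[0, +oo[].

Let Winf_lb j : has_lbound [set W j t | t in `[0, +oo[].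
Proof. by exists 0 => _ [t /= /[!in_itv]/= /andP[t0 _] <-]; exact: W_ge0. Qed.

Let Winf_le j t : 0 <= t -> Winf j <= W j t.
Proof. by move=> t0; apply: ge_inf => //; exists t => //=; rewrite in_itv/= t0. Qed.

Let Winf_ge0 j : 0 <= Winf j.
Proof.
apply: lb_le_inf; first by exists (W j 0), 0 => //=; rewrite in_itv/= lexx.
by move=> _ [t /= /[!in_itv]/= /andP[t0 _] <-]; exact: W_ge0.
Qed.

Let Winf_approx j e : 0 < e ->
  exists2 T, 0 <= T & forall t, T <= t -> W j t <= Winf j + e.
Proof.
move=> e0.
have hi : has_inf [set W j t | t in `[0, +oo[].
  split; last exact: Winf_lb.
  by exists (W j 0), 0 => //=; rewrite in_itv/= lexx.
have [_ [T /= /[!in_itv]/= /andP[T0 _] <-] WT] := inf_adherent e0 hi.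
by exists T => // t Tt; exact: (le_trans (W_anti j T0 Tt) (ltW WT)).
Qed.

(** The estimate at time s + t with bounds M_j = W_j(s): as t grows, b_i(t)
    vanishes, and as s grows, gain_ij(W_j(s)) tends to gain_ij(Winf_j). *)
Let Winf_small_gain i : 0 <= c -> Winf i <= \sum_j gain i j (Winf j) + c.
Proof.
move=> c0; apply/ler_addgt0Pr => e e0.
(* one share of e for each of the n gains and one for b_i *)
have e' : 0 < e / (n%:R + 1) by rewrite divr_gt0// ltr_wpDl.
have H j : exists T, 0 <= T /\ gain i j (W j T) <= gain i j (Winf j) + e / (n%:R + 1) /\
    forall t, T <= t -> gain i j (W j t) <= gain i j (Winf j) + e / (n%:R + 1).
  have [d d0 Hd] := class_K_or_zero_right_continuous (gainK i j) (Winf_ge0 j) e'.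
  have [T T0 HT] := Winf_approx j d0.
  have HT' t : T <= t -> gain i j (W j t) <= gain i j (Winf j) + e / (n%:R + 1).
    move=> Tt; apply: Hd; rewrite HT// andbT; apply: Winf_le; exact: le_trans Tt.
  by exists T; split=> //; split=> //; exact: HT'.
have /choice[T TP] := H.
have T0 j : 0 <= T j by have [] := TP j.
have [S S0 HS] := b0 i e'.
pose s := \sum_j T j.
have s0 : 0 <= s by apply: sumr_ge0.
have Ts j : T j <= s by rewrite /s (bigD1 j)//= lerDl; apply: sumr_ge0.
apply: le_trans (Winf_le i (addr_ge0 s0 S0)) _.
apply: W_le.
  apply: addr_ge0; last exact: ltW.
  apply: addr_ge0 => //; apply: sumr_ge0 => j _.
  exact: (modulus_ge0 (gainM _ _)).
move=> p r sr; have sr' : 0 <= r - s by lra.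
rewrite -[r](subrK s) addrC.
apply: le_trans (@y_est p i s (r - s) (fun j => W j s) s0 sr' _) _.
  by move=> j q sq; exact: y_W.
have h1 : b i (r - s) <= e / (n%:R + 1) by apply: HS; lra.
have h2 : \sum_j gain i j (W j s) <= \sum_j gain i j (Winf j) + n%:R * (e / (n%:R + 1)).
  rewrite -[X in X%:R * _]card_ord mulr_natl -sumr_const -big_split/=.
  by apply: ler_sum => j _; have [_ [_]] := TP j; exact.
have h3 : n%:R * (e / (n%:R + 1)) + e / (n%:R + 1) = e.
  by field; rewrite gt_eqF// ltr_wpDl.
lra.
Qed.

(** The times T are common to all members p of the family because the limit is
    taken after the supremum over p. *)
Lemma uniform_attractivity (phi : R -> R) : 0 <= c ->
  (forall w : 'I_n -> R, (forall i, 0 <= w i) ->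
     (forall i, w i <= \sum_j gain i j (w j) + c) -> forall i, w i <= phi c) ->
  forall e, 0 < e ->
  exists2 T, 0 <= T & forall p i t, T <= t -> y p i t <= phi c + e.
Proof.
move=> c0 Hphi e e0.
have /choice[T TP] : forall j, exists T, 0 <= T /\
    forall t, T <= t -> W j t <= Winf j + e.
  by move=> j; have [T T0 HT] := Winf_approx j e0; exists T.
have T0 j : 0 <= T j by have [] := TP j.
exists (\sum_j T j) => [|p i t Tt]; first exact: sumr_ge0.
have Ti : T i <= t.
  by apply: le_trans Tt; rewrite (bigD1 i)//= lerDl; apply: sumr_ge0.
apply: le_trans (y_W p i (le_trans (T0 i) Ti) (lexx t)) _.
have [_ /(_ _ Ti) /le_trans] := TP i; apply; rewrite lerD2r.
by apply: Hphi => // j; exact: Winf_small_gain.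
Qed.

End Attractivity.

Section KLEstimate.
Context {R : realType}.
Variables (P : Type) (a v : P -> R) (h : P -> R -> R) (sigma kappa kappa1 : R -> R).
Hypothesis a_ge0 : forall p, 0 <= a p.
Hypothesis v_ge0 : forall p, 0 <= v p.
Hypothesis sigmaM : modulus sigma.
Hypothesis kappaM : modulus kappa.
Hypothesis kappa1M : modulus kappa1.
Hypothesis stable : forall p t, 0 <= t -> h p t <= sigma (a p) + kappa (v p).
Hypothesis attractive : forall r w e, 0 <= r -> 0 <= w -> 0 < e ->
  exists2 T, 0 <= T & forall p t, a p <= r -> v p <= w -> T <= t ->
    h p t <= kappa1 w + e.

(** The argument 2 w leaves room for a factor 2 in the input bound used in
    [attractive_dyadic]; the summand w makes G unbounded, so that stability alone
    gives the estimate for inputs with v p > sigma r. *)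
Let G w := kappa1 (2 * w) + kappa w + w.

Let GM : modulus G.
Proof.
apply: modulusD; last exact: modulus_id.
by apply: modulusD => //; apply: modulus_comp => //; apply: modulusZ => //; exact: modulus_id.
Qed.

(** Attractivity depends on an upper bound w of the input, whereas the estimate
    must involve the input itself.  On v p in [w / 2, w] the two are comparable,
    and finitely many such intervals cover [V / 2 ^ k, V]. *)
Let attractive_dyadic r V e : 0 <= r -> 0 <= V -> 0 < e -> forall k : nat,
  exists2 T, 0 <= T & forall p t, a p <= r -> V / 2 ^+ k <= v p <= V -> T <= t ->
    h p t <= G (v p) + e.
Proof.
move=> r0 V0 e0.
have H w : 0 <= w -> exists2 T, 0 <= T & forall p t, a p <= r ->
    w <= 2 * v p -> v p <= w -> T <= t -> h p t <= G (v p) + e.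
  move=> w0; have [T T0 HT] := attractive r0 w0 e0; exists T => // p t ar wv vw Tt.
  apply: le_trans (HT p t ar vw Tt) _; rewrite lerD2r /G -addrA.
  have [_ k1m _] := kappa1M; apply: ler_wpDr; last exact: k1m.
  by rewrite addr_ge0// (modulus_ge0 kappaM).
elim=> [|k [T1 T10 HT1]].
  have [T T0 HT] := H V V0; exists T => // p t ar; rewrite expr0 divr1 => /andP[h1 h2].
  by apply: HT => //; have := v_ge0 p; lra.
have w0 : 0 <= V / 2 ^+ k by rewrite divr_ge0 ?exprn_ge0.
have [T2 T20 HT2] := H _ w0.
exists (T1 + T2) => [|p t ar /andP[h1 h2] Tt]; first exact: addr_ge0.
have [hk|hk] := leP (V / 2 ^+ k) (v p).
  by apply: HT1 => //; [rewrite hk|lra].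
apply: HT2 => //; [|exact: ltW|lra].
by move: h1; rewrite exprS invfM mulrCA -[leRHS]mulr1; lra.
Qed.

(** Large inputs are covered by stability, intermediate ones by
    [attractive_dyadic], and for small ones kappa1 is below e / 2. *)
Let attractive_uniform r e : 0 <= r -> 0 < e ->
  exists2 T, 0 <= T & forall p t, a p <= r -> T <= t -> h p t <= G (v p) + e.
Proof.
move=> r0 e0; have e2 : 0 < e / 2 by rewrite divr_gt0.
pose V := sigma r; have V0 : 0 <= V by exact: (modulus_ge0 sigmaM).
have [_ k1m k1c] := kappa1M; have [d d0 Hd] := k1c _ e2.
have [k Hk] := geometric_small V d0.
have w0 : 0 <= V / 2 ^+ k by rewrite divr_ge0 ?exprn_ge0.
have [T1 T10 HT1] := attractive_dyadic r0 V0 e0 k.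
have [T2 T20 HT2] := attractive r0 w0 e2.
exists (T1 + T2) => [|p t ar Tt]; first exact: addr_ge0.
have G0 : 0 <= G (v p) by exact: (modulus_ge0 GM).
have [vV|Vv] := leP (v p) V; last first.
  apply: le_trans (stable p _) _; first lra.
  have : sigma (a p) <= V by have [_ sm _] := sigmaM; exact: sm.
  have := modulus_ge0 kappa1M (mulr_ge0 (ler0n _ 2) (v_ge0 p)).
  rewrite /G; lra.
have [vk|kv] := leP (V / 2 ^+ k) (v p).
  by apply: HT1 => //; [rewrite vk|lra].
apply: le_trans (HT2 p t ar (ltW kv) _) _; first lra.
have : kappa1 (V / 2 ^+ k) <= kappa1 d by exact: k1m.
lra.
Qed.

(** The function g r t is the largest excess of h over G after time t among the
    trajectories with a p <= r; stability bounds it by sigma r, attractivity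
    makes it vanish as t grows. *)
Lemma KL_estimate : exists beta gamma, [/\ class_KL beta, class_K gamma &
  forall p t, 0 <= t -> h p t <= beta (a p) t + gamma (v p)].
Proof.
pose S r t := [set z | z = 0 \/
  exists p s, [/\ a p <= r, t <= s & z = h p s - G (v p)]].
pose g r t := sup (S r t).
have excess p s : 0 <= s -> h p s - G (v p) <= sigma (a p).
  move=> s0; have := stable p s0.
  have := modulus_ge0 kappa1M (mulr_ge0 (ler0n _ 2) (v_ge0 p)).
  have := v_ge0 p; rewrite /G; lra.
have sm : forall r s, 0 <= r -> r <= s -> sigma r <= sigma s by case: sigmaM.
have g_ub r t z : 0 <= r -> 0 <= t -> S r t z -> z <= g r t.
  move=> r0 t0 Sz; apply: ub_le_sup => //; exists (sigma r).
  move=> w [->|[p [s [ar ts ->]]]]; first exact: (modulus_ge0 sigmaM).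
  by apply: le_trans (excess p s (le_trans t0 ts)) _; exact: sm.
have g_le r t M : 0 <= M -> (forall p s, a p <= r -> t <= s -> h p s - G (v p) <= M) ->
    g r t <= M.
  move=> M0 H; apply: ge_sup; first by exists 0; left.
  by move=> z [->|[p [s [ar ts ->]]]] //; exact: H.
have g_ge0 r t : 0 <= r -> 0 <= t -> 0 <= g r t by move=> *; apply: g_ub => //; left.
have g_sigma r t : 0 <= r -> 0 <= t -> g r t <= sigma r.
  move=> r0 t0; apply: g_le => [|p s ar ts]; first exact: (modulus_ge0 sigmaM).
  by apply: le_trans (excess p s (le_trans t0 ts)) _; exact: sm.
have [|||beta betaKL gbeta] := @class_KL_majorant R g.
- move=> t t0; split=> [|r s r0 rs|e e0].
  + apply/eqP; rewrite eq_le g_ge0// andbT; apply: le_trans (g_sigma _ _ _ t0) _ => //.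
    by case: sigmaM => ->.
  + have s0 := le_trans r0 rs.
    apply: g_le => [|p q ar tq]; first exact: g_ge0.
    by apply: g_ub => //; right; exists p, q; split=> //; exact: le_trans rs.
  + have [_ _ sc] := sigmaM; have [d d0 Hd] := sc _ e0; exists d => //.
    by apply: le_trans Hd; apply: g_sigma => //; exact: ltW.
- move=> r t1 t2 r0 t10 t12; apply: g_le => [|p q ar tq]; first exact: g_ge0.
  by apply: g_ub => //; right; exists p, q; split=> //; exact: le_trans tq.
- move=> r e r0 e0; have [T T0 HT] := attractive_uniform r0 e0; exists T => //.
  by apply: g_le => [|p s ar Ts]; [exact: ltW|rewrite lerBlDl HT].
have [gamma gammaK Ggamma] := class_K_majorant GM.
exists beta, gamma; split=> // p t t0.
rewrite -[h p t](subrK (G (v p))); apply: lerD; last exact: Ggamma.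
by apply: le_trans (gbeta _ _ _ t0) => //; apply: g_ub => //; right; exists p, t.
Qed.

End KLEstimate.

(** * Existence and uniqueness for the interconnection *)

Section CutOff.
Context {R : realType} {m : nat}.

Definition clampV (r : R) (x : 'cV[R]_m) : 'cV[R]_m :=
  \col_k Num.max (- r) (Num.min (x k 0) r).

Lemma clampV_le r x : 0 <= r -> `|clampV r x| <= r.
Proof.
move=> r0; apply: mx_norm_le => // k j; rewrite mxE ler_norml le_max lexx/=.
by rewrite ge_max ge_min lexx orbT andbT; lra.
Qed.

Lemma clampV_id r x : `|x| <= r -> clampV r x = x.
Proof.
move=> xr; apply/matrixP => k j; rewrite mxE ord1.
have := le_trans (mx_entry_le x k 0) xr; rewrite ler_norml => /andP[h1 h2].
by rewrite min_l// max_r.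
Qed.

Lemma clampV_lipschitz r x y : `|clampV r x - clampV r y| <= `|x - y|.
Proof.
apply: mx_norm_le => // k j; rewrite !mxE; apply: le_trans (clamp_lipschitz _ _ _ _) _.
by have := mx_entry_le (x - y) k 0; rewrite !mxE.
Qed.

Lemma clampV_continuous r : continuous (clampV r).
Proof.
move=> x; apply/(@cvgrPdist_lt _ _ _ (nbhs x) (nbhs_filter x)) => e e0.
have := @near_dist_lt _ _ x e e0; apply: filterS => y xy.
exact: le_lt_trans (clampV_lipschitz _ _ _) xy.
Qed.

End CutOff.

Section Trapping.
Context {R : realType}.

(** At the first time T with h T >= r the bound c holds on [0, T[, hence at T by
    continuity (or as the initial bound if T = 0), which contradicts c < r. *)
Lemma trapping (h : R -> R) (c r : R) : c < r ->
  {within `[0, +oo[, continuous h} -> h 0 <= c ->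
  (forall T, 0 < T -> (forall s, 0 <= s < T -> h s < r) ->
     forall s, 0 <= s < T -> h s <= c) ->
  forall t, 0 <= t -> h t < r.
Proof.
move=> cr /within_continuousP hc h0 H t t0; rewrite ltNge; apply/negP => rt.
pose S := [set s | 0 <= s /\ r <= h s].
have Si : has_inf S by split; [exists t|exists 0 => s []].
pose T := inf S.
have T0 : 0 <= T by apply: lb_le_inf; [exists t|move=> s []].
have below s : 0 <= s < T -> h s < r.
  move=> /andP[s0 sT]; rewrite ltNge; apply/negP => rs.
  by move: sT; rewrite ltNge; apply/negP/negPn; apply: ge_inf; [case: Si|split].
have hT : h T <= c.
  move: T0; rewrite le_eqVlt => /predU1P[<-//|Tp].
  apply/ler_addgt0Pr => e e0.
  have [|d d0 Hd] := hc T _ e e0; first by rewrite /= in_itv/= ltW.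
  pose s := Num.max 0 (T - d / 2).
  have sT : 0 <= s < T by rewrite /s le_max lexx gt_max Tp/=; lra.
  have h1 := H T Tp below s sT.
  have : `|h T - h s| <= e.
    have /andP[s0 sT'] := sT.
    apply: Hd; first by rewrite /= in_itv/= s0.
    rewrite ger0_norm ?subr_ge0 ?ltW//.
    have : T - d / 2 <= s by rewrite /s le_max lexx orbT.
    lra.
  by move=> /(le_trans (ler_norm _)); lra.
have rc : 0 < (r - c) / 2 by lra.
have [|d d0 Hd] := hc T _ _ rc; first by rewrite /= in_itv/= T0.
have [s [s0 rs] sT] := inf_adherent d0 Si.
have Ts : T <= s by apply: ge_inf; [case: Si|split].
have : `|h T - h s| <= (r - c) / 2.
  apply: Hd; first by rewrite /= in_itv/= s0.
  by rewrite distrC ger0_norm ?subr_ge0// ltrBlDl.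
by rewrite ler_norml => /andP[]; lra.
Qed.

End Trapping.

Section Integrability.
Context {R : realType}.
Notation mu := (@lebesgue_measure R).

Lemma ae_eq_integrable (D : set R) (f g : R -> \bar R) :
  measurable D -> measurable_fun D f -> ae_eq mu D f g ->
  mu.-integrable D g -> mu.-integrable D f.
Proof.
move=> mD mf fg /integrableP[mg ig]; apply/integrableP; split=> //.
suff -> : (\int[mu]_(s in D) `|f s| = \int[mu]_(s in D) `|g s|)%E by [].
apply: ge0_ae_eq_integral => //.
- exact: measurableT_comp.
- exact: measurableT_comp.
- by apply: filterS fg => s H /H /= ->.
Qed.

End Integrability.

Section Interconnection.
Context {R : realType}.
Notation mu := (@lebesgue_measure R).
Variable nrm : forall m, 'cV[R]_m -> R.
Hypothesis nrmN : forall m, is_norm (nrm (m := m)).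
Variables (n l : nat) (N : 'I_n -> nat).
Variable f : forall i, 'cV[R]_(\sum_j N j) -> 'cV[R]_l -> 'cV[R]_(N i).
Arguments nrm {m}.
Hypothesis f_continuous : forall i, continuous (fun xu => f i xu.1 xu.2).
Hypothesis f_lipschitz : forall i, lipschitz_on_bounded (@nrm) (f i).
Notation F := (interconnection f).
Notation m := (\sum_j N j)%N.

Lemma interconnection_coord_continuous k :
  continuous (fun xu : 'cV[R]_m * 'cV[R]_l => F xu.1 xu.2 k 0).
Proof.
rewrite (_ : (fun xu => _) = (fun v : 'cV[R]_(N (tagnat.sig1 k)) =>
    v (tagnat.sig2 k) 0) \o (fun xu => f (tagnat.sig1 k) xu.1 xu.2)).
  move=> xu; apply: continuous_comp; first exact: f_continuous.
  exact: coord_continuous.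
by apply/funext => xu; rewrite /= mxE.
Qed.

Lemma interconnection_lipschitz r : exists2 K, 0 < K & forall x y u,
  `|x| <= r -> `|y| <= r -> `|F x u - F y u| <= K * `|x - y|.
Proof.
have [C C0 HC] := is_norm_le_mx_norm (nrmN m).
have H i : exists K, 0 <= K /\ forall x y u,
    `|x| <= r -> `|y| <= r -> `|f i x u - f i y u| <= K * `|x - y|.
  have [D D0 HD] := mx_norm_le_is_norm (nrmN (N i)).
  have [K HK] := f_lipschitz i (C * r).
  exists (D * (`|K| * C)); split; first by rewrite !mulr_ge0// ltW.
  move=> x y u xr yr; apply: le_trans (HD _) _; rewrite -mulrA ler_wpM2l ?(ltW D0)//.
  apply: le_trans (HK x y u _ _) _.
  - by apply: le_trans (HC _) _; rewrite ler_wpM2l ?(ltW C0).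
  - by apply: le_trans (HC _) _; rewrite ler_wpM2l ?(ltW C0).
  - apply: (@le_trans _ _ (`|K| * nrm (x - y))).
      by rewrite ler_wpM2r ?(is_norm_ge0 (nrmN _))// ler_norm.
    by rewrite -mulrA ler_wpM2l.
have /choice[K KP] := H; have K0 i : 0 <= K i by have [] := KP i.
exists (\sum_i K i + 1) => [|x y u xr yr].
  by rewrite ltr_wpDl// sumr_ge0.
apply: le_trans (norm_le_sum_submxcol _) _.
rewrite mulrDl mul1r; apply: ler_wpDr => //; rewrite mulr_suml.
apply: ler_sum => i _; rewrite submxcolB !mxcolK.
by have [_] := KP i; exact.
Qed.

Section CutOffSolution.
Variables (u : R -> 'cV[R]_l) (x0 : 'cV[R]_m) (r : R).
Hypothesis u_bounded : ess_bounded (@nrm) u.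
Hypothesis r_ge0 : 0 <= r.

Let g (s : R) (x : 'cV[R]_m) := F (clampV r x) (u s).

Let g_measurable (T : R) (x : R -> 'cV[R]_m) : 0 <= T -> {within `[0, T], continuous x} ->
  forall k, measurable_fun `[0, T] (fun s => g s (x s) k 0).
Proof.
move=> T0 cx k.
apply: (@measurable_fun_continuous_coord _ _ _ `[0, T]%classic _ _
  (fun xu => F xu.1 xu.2 k 0) (fun s => clampV r (x s)) u) => //.
- exact: interconnection_coord_continuous.
- move=> i; apply: within_continuous_measurable => //.
  apply: within_continuous_coord.
  move=> s; apply: continuous_comp; first exact: cx.
  exact: clampV_continuous.
- move=> i; have [um _] := u_bounded.
  apply: measurable_funS (um i) => //.
  by apply: subset_itvl.
Qed.

(** The input is bounded almost everywhere, so it equals its clamped version up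
    to a null set, and a continuous function is bounded on a compact ball. *)
Let g_integrable0 (T : R) k : 0 <= T -> mu.-integrable `[0, T] (fun s => (g s 0 k 0)%:E).
Proof.
move=> T0.
have [C C0 HC] := mx_norm_le_is_norm (nrmN l).
pose V := C * fine (linf_norm (@nrm) u).
have V0 : 0 <= V by rewrite mulr_ge0 ?(ltW C0)// fine_linf_norm_ge0.
have [um _] := u_bounded.
have umT i : measurable_fun `[0, T] (fun s => u s i 0).
  by apply: measurable_funS (um i) => //; apply: subset_itvl.
have mG (w : R -> 'cV[R]_l) : (forall i, measurable_fun `[0, T] (fun s => w s i 0)) ->
    measurable_fun `[0, T] (fun s => F 0 (w s) k 0).
  move=> mw; apply: (@measurable_fun_continuous_coord _ _ _ `[0, T]%classic _ _
    (fun xu => F xu.1 xu.2 k 0) (fun=> 0) w) => //.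
  exact: interconnection_coord_continuous.
have mclamp i : measurable_fun `[0, T] (fun s => clampV V (u s) i 0).
  rewrite (_ : (fun s => _) = (fun s => Num.max (- V) (Num.min (u s i 0) V))).
    by apply: measurable_maxr => //; apply: measurable_minr.
  by apply/funext => s; rewrite mxE.
have cl0 : clampV r (0 : 'cV[R]_m) = 0 by apply: clampV_id; rewrite normr0.
apply: (@ae_eq_integrable _ _ _ (fun s => (F 0 (clampV V (u s)) k 0)%:E)) => //.
- by apply/measurable_EFinP; rewrite /g cl0; exact: mG.
- have := ess_bounded_ae nrmN u_bounded.
  apply: (@filterS _ (almost_everywhere mu)) => s H /=; rewrite in_itv/= => /andP[s0 _].
  rewrite /g cl0 clampV_id//; apply: le_trans (HC _) _.
  by rewrite ler_wpM2l ?(ltW C0) ?H.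
- have cF : continuous (fun w : 'cV[R]_l => F 0 w k 0).
    move=> w; apply: (@continuous_comp _ _ _ (fun w : 'cV[R]_l => ((0 : 'cV[R]_m), w))
      (fun xu => F xu.1 xu.2 k 0)); last exact: interconnection_coord_continuous.
    apply: (@cvg_pair _ _ _ (nbhs w) (nbhs (0 : 'cV[R]_m)) (nbhs w)
      (nbhs_filter _) (nbhs_filter _) (nbhs_filter _) (fun=> 0) id).
      exact: cvg_cst.
    exact: cvg_id.
  have /compact_bounded[B [_ HB]] :
      compact ((fun w => F 0 w k 0) @` [set w : 'cV[R]_l | `|w| <= V]).
    apply: continuous_compact; last exact: cV_ball_compact.
    exact: continuous_subspaceT.
  have iB : mu.-integrable `[0, T] (EFin \o (fun=> `|B| + 1)).
    apply: continuous_compact_integrable; first exact: segment_compact.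
    by apply: continuous_subspaceT => s; exact: cvg_cst.
  apply: (le_integrable _ _ _ iB) => //.
    by apply/measurable_EFinP; exact: mG.
  move=> s _ /=; rewrite lee_fin [leRHS]ger0_norm ?addr_ge0//.
  apply: HB; first by rewrite (le_lt_trans (ler_norm _))// ltrDl.
  by exists (clampV V (u s)) => //=; exact: clampV_le.
Qed.

Lemma cut_off_solution : exists x, ode_solution g x0 `[0, +oo[ x.
Proof.
have [K K0 HK] := interconnection_lipschitz r.
apply: (picard_existence x0 K0 g_measurable _ g_integrable0) => s v w.
apply: le_trans (HK _ _ _ _ _) _; rewrite ?clampV_le//.
by rewrite ler_wpM2l ?(ltW K0)// clampV_lipschitz.
Qed.

End CutOffSolution.

Lemma interconnection_unique (u : R -> 'cV[R]_l) x0 b y z :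
  ode_solution (fun t x => F x (u t)) x0 `[0, b[ y ->
  ode_solution (fun t x => F x (u t)) x0 `[0, b[ z -> {in `[0, b[, y =1 z}.
Proof.
move=> soly solz; apply: (ode_solution_unique soly solz) => T Tb.
have sub : `[0, T] `<=` `[0, b[ by apply: subset_itvl; rewrite bnd_simp.
have [cy _] := soly; have [cz _] := solz.
have [A A0 HA] := within_continuous_bounded (within_continuous_subset sub cy).
have [B B0 HB] := within_continuous_bounded (within_continuous_subset sub cz).
have [K K0 HK] := interconnection_lipschitz (A + B).
exists K => s sT; apply: HK.
  by apply: le_trans (HA s sT) _; rewrite lerDl ltW.
by apply: le_trans (HB s sT) _; rewrite lerDr ltW.
Qed.

(** A bound on all solutions turns Lipschitz continuity on bounded sets into
    global existence: with the cut-off radius above that bound, the solution of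
    the cut-off system stays where the cut-off acts as the identity. *)
Lemma interconnection_unique_global (u : R -> 'cV[R]_l) x0 (B : R) :
  ess_bounded (@nrm) u ->
  (forall b x, ode_solution (fun t x => F x (u t)) x0 `[0, b[ x ->
     forall t, 0 <= t < b -> `|x t| <= B) ->
  unique_global_solution (fun t x => F x (u t)) x0.
Proof.
move=> ub HB.
pose c := Num.max B `|x0|.
have c0 : 0 <= c by rewrite /c le_max normr_ge0 orbT.
have cr : c < c + 1 by rewrite ltrDl.
have r0 : 0 <= c + 1 by rewrite addr_ge0.
have [x solx] := cut_off_solution x0 ub r0.
have [cx _] := solx.
have down (T s : R) : `[0, T[%classic s -> `[0, s] `<=` `[0, T[.
  by rewrite /= in_itv/= => /andP[_ sT]; apply: subset_itvl; rewrite bnd_simp.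
have xc t : 0 <= t -> `|x t| < c + 1.
  move: t; apply: (@trapping _ (fun t => `|x t|) c) => //.
  - by move=> s; apply: continuous_comp; [exact: cx|exact: norm_continuous].
  - rewrite (ode_solution0 _ solx) ?/= ?in_itv/= ?lexx//.
    by rewrite /c le_max lexx orbT.
  - move=> T T0 xr s sT; rewrite /c le_max; apply/orP; left.
    apply: (HB T x) => //.
    have solT : ode_solution (fun s x => F (clampV (c + 1) x) (u s)) x0 `[0, T[ x.
      by apply: ode_solution_subset solx; apply: subset_itvl.
    apply: ode_solution_congr solT => //; first exact: down.
    by move=> q; rewrite /= in_itv/= => /xr qr; rewrite clampV_id// ltW.
have sol : ode_solution (fun t x => F x (u t)) x0 `[0, +oo[ x.
  apply: ode_solution_congr solx => //.
    by move=> t _ s /=; rewrite !in_itv/= andbT => /andP[].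
  by move=> t; rewrite /= in_itv/= andbT => /xc tr; rewrite clampV_id// ltW.
exists x; split=> // b y soly.
apply: interconnection_unique soly _.
by apply: ode_solution_subset sol; apply: subset_itvl.
Qed.

End Interconnection.

(** * The small gain theorem *)

Section SmallGainTheorem.
Context {R : realType}.
Variable nrm : forall m, 'cV[R]_m -> R.
Hypothesis nrmN : forall m, is_norm (nrm (m := m)).
Variables (n l : nat) (N : 'I_n -> nat).
Variable f : forall i, 'cV[R]_(\sum_j N j) -> 'cV[R]_l -> 'cV[R]_(N i).
Arguments nrm {m}.
Notation F := (interconnection f).
Notation m := (\sum_j N j)%N.

Lemma block_norm_le : exists2 C, 0 < C & forall i (x : 'cV[R]_m),
  nrm (submxcol x i) <= C * nrm x.
Proof.
have [D D0 HD] := mx_norm_le_is_norm (nrmN m).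
have /choice[C CP] : forall i, exists C, 0 < C /\ forall x : 'cV[R]_(N i), nrm x <= C * `|x|.
  by move=> i; have [C] := is_norm_le_mx_norm (nrmN (N i)); exists C.
have C0 i : 0 < C i by have [] := CP i.
exists (D * (\sum_i C i + 1)).
  by rewrite mulr_gt0// ltr_wpDl// sumr_ge0// => i _; exact: ltW.
move=> i x; have [_ /(_ (submxcol x i)) /le_trans] := CP i; apply.
apply: (@le_trans _ _ (C i * (D * nrm x))).
  rewrite ler_wpM2l ?(ltW (C0 _))//.
  by apply: le_trans (submxcol_norm_le _ _) (HD _).
rewrite mulrCA -mulrA ler_wpM2l ?(ltW D0)// ler_wpM2r ?is_norm_ge0//.
rewrite (bigD1 i)//= -addrA lerDl addr_ge0// sumr_ge0// => j _; exact: ltW.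
Qed.

Lemma norm_le_block_sum : exists2 C, 0 < C & forall x : 'cV[R]_m,
  nrm x <= C * \sum_i nrm (submxcol x i).
Proof.
have [D D0 HD] := is_norm_le_mx_norm (nrmN m).
have /choice[C CP] : forall i, exists C, 0 < C /\ forall x : 'cV[R]_(N i), `|x| <= C * nrm x.
  by move=> i; have [C] := mx_norm_le_is_norm (nrmN (N i)); exists C.
have C0 i : 0 < C i by have [] := CP i.
exists (D * (\sum_i C i + 1)).
  by rewrite mulr_gt0// ltr_wpDl// sumr_ge0// => i _; exact: ltW.
move=> x; apply: le_trans (HD x) _; rewrite -mulrA ler_wpM2l ?(ltW D0)//.
apply: le_trans (norm_le_sum_submxcol x) _; rewrite mulr_sumr.
apply: ler_sum => i _; have [_ /(_ (submxcol x i)) /le_trans] := CP i; apply.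
rewrite ler_wpM2r ?is_norm_ge0//.
rewrite (bigD1 i)//= -addrA lerDl addr_ge0// sumr_ge0// => j _; exact: ltW.
Qed.

Variables (beta : 'I_n -> R -> R -> R) (gain : 'I_n -> 'I_n -> R -> R) (gamma : R -> R).
Hypothesis betaKL : forall i, class_KL (beta i).
Hypothesis gainK : forall i j, class_K_or_zero (gain i j).
Hypothesis gammaK : class_K gamma.
Hypothesis subsystems : forall i, subsystem_ISS (@nrm) f i (beta i) (gain i) gamma.
Variable phi : R -> R.
Hypothesis phiM : modulus phi.
Hypothesis phi_bound : forall (w : 'I_n -> R) c, 0 <= c -> (forall i, 0 <= w i) ->
  (forall i, w i <= \sum_j gain i j (w j) + c) -> forall i, w i <= phi c.

Let gainM i j : modulus (gain i j).
Proof. exact/class_K_or_zero_modulus/gainK. Qed.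

Let gammaM : modulus gamma.
Proof. exact: class_K_modulus. Qed.

Let betaM i t : 0 <= t -> modulus (beta i ^~ t).
Proof. by move=> t0; apply: class_K_modulus; have [H _] := betaKL i; exact: H. Qed.

Let beta_anti i s t : 0 <= s -> 0 <= t -> beta i s t <= beta i s 0.
Proof.
move=> s0 t0; have [_ /(_ s s0)[H _]] := betaKL i.
by apply: H; rewrite ?in_itv/= ?lexx ?t0.
Qed.

Let linf0 p (v : R -> 'cV[R]_p) : 0 <= fine (linf_norm (@nrm) v).
Proof. exact: fine_linf_norm_ge0. Qed.

Let phi_add a b : 0 <= a -> 0 <= b -> phi (a + b) <= phi (2 * a) + phi (2 * b).
Proof.
move=> a0 b0; have [_ pm _] := phiM.
have ha : 0 <= phi (2 * a) by rewrite (modulus_ge0 phiM)// mulr_ge0.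
have hb : 0 <= phi (2 * b) by rewrite (modulus_ge0 phiM)// mulr_ge0.
have [ab|/ltW ba] := leP a b.
  by apply: ler_wpDl => //; apply: pm; [exact: addr_ge0|lra].
by apply: ler_wpDr => //; apply: pm; [exact: addr_ge0|lra].
Qed.

(** The suprema of the block norms over [0, t] satisfy the small gain
    inequality, because beta_i is largest at time 0. *)
Lemma block_stability (u : R -> 'cV[R]_l) x0 b (x : R -> 'cV[R]_m) t i :
  ess_bounded (@nrm) u ->
  ode_solution (fun t y => F y (u t)) x0 `[0, b[ x -> 0 <= t < b ->
  nrm (submxcol (x t) i) <=
    phi (\sum_j beta j (nrm (submxcol x0 j)) 0 + gamma (fine (linf_norm (@nrm) u))).
Proof.
move=> ub sol /andP[t0 tb].
pose S j := [set nrm (submxcol (x s) j) | s in `[0, t]].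
have sub : `[0, t] `<=` `[0, b[ by apply: subset_itvl; rewrite bnd_simp.
have ubS j : has_ubound (S j).
  have [cx _] := sol.
  have [D D0 HD] := within_continuous_bounded (within_continuous_subset sub cx).
  have [C C0 HC] := is_norm_le_mx_norm (nrmN (N j)).
  exists (C * D) => _ [s /= /[!in_itv]/= st <-].
  apply: le_trans (HC _) _; rewrite ler_wpM2l ?(ltW C0)//.
  exact: le_trans (submxcol_norm_le _ _) (HD s st).
pose M j := sup (S j).
have leM j s : 0 <= s <= t -> nrm (submxcol (x s) j) <= M j.
  by move=> st; apply: ub_le_sup => //; exists s => //=; rewrite in_itv.
have tt : 0 <= t <= t by rewrite t0 lexx.
apply: (le_trans (leM i t tt)); move: i; apply: phi_bound.
- apply: addr_ge0; last exact: (modulus_ge0 gammaM).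
  by apply: sumr_ge0 => j _; apply: (modulus_ge0 (betaM j (lexx 0))); exact: is_norm_ge0.
- by move=> j; apply: le_trans (leM j t tt); exact: is_norm_ge0.
move=> i; apply: ge_sup.
  by exists (nrm (submxcol (x t) i)), t => //=; rewrite in_itv.
move=> _ [s /= /[!in_itv]/= /andP[s0 st] <-].
have sb : 0 <= s < b by rewrite s0 (le_lt_trans st).
have := subsystem_estimate nrmN (M := M) (subsystems i) (gainM i) ub sol sb.
move=> /(_ _)/wrap[].
  by move=> j r /andP[r0 rs]; apply: leM; rewrite r0 (le_trans rs).
move=> /le_trans; apply; rewrite addrA lerD2r [leRHS]addrC lerD2r.
apply: le_trans (beta_anti _ _ s0) _; first exact: is_norm_ge0.
rewrite (bigD1 i)//= lerDl; apply: sumr_ge0 => j _.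
by apply: (modulus_ge0 (betaM j (lexx 0))); exact: is_norm_ge0.
Qed.

Hypothesis f_continuous : forall i, continuous (fun xu => f i xu.1 xu.2).
Hypothesis f_lipschitz : forall i, lipschitz_on_bounded (@nrm) (f i).

(** Trajectories are pairs of an input and a solution on the half-line.
    Attractivity is applied to the subfamilies with |x(0)| <= r and ||u|| <= w,
    where the restart of the subsystem estimates at time s is a time shift of
    both the input and the solution. *)
Lemma interconnection_ISS : ISS (@nrm) F.
Proof.
have [Cs Cs0 HCs] := block_norm_le.
have [C C0 HC] := norm_le_block_sum.
pose Cn := C * n%:R; have Cn0 : 0 <= Cn by rewrite mulr_ge0// ltW.
have HCn (x : 'cV[R]_m) B : (forall i, nrm (submxcol x i) <= B) -> nrm x <= Cn * B.
  move=> HB; apply: le_trans (HC x) _; rewrite /Cn -mulrA ler_wpM2l ?(ltW C0)//.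
  apply: (@le_trans _ _ (\sum_(i < n) B)); first exact: ler_sum.
  by rewrite sumr_const card_ord mulr_natl.
split=> [x0 u ub|].
  have [D D0 HD] := mx_norm_le_is_norm (nrmN m).
  pose c := \sum_j beta j (nrm (submxcol x0 j)) 0 + gamma (fine (linf_norm (@nrm) u)).
  apply: (@interconnection_unique_global _ _ nrmN _ _ _ _ f_continuous f_lipschitz
    u x0 (D * (Cn * phi c)) ub) => b x sol t tb.
  apply: le_trans (HD _) _; rewrite ler_wpM2l ?(ltW D0)//.
  by apply: HCn => i; exact: block_stability ub sol tb.
pose traj := {p : (R -> 'cV[R]_l) * (R -> 'cV[R]_m) | ess_bounded (@nrm) p.1 /\
  ode_solution (fun t y => F y (p.1 t)) (p.2 0) `[0, +oo[ p.2}.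
pose a (p : traj) := nrm ((sval p).2 0).
pose v (p : traj) := fine (linf_norm (@nrm) (sval p).1).
pose h (p : traj) t := nrm ((sval p).2 t).
pose B0 r := \sum_j beta j (Cs * r) 0.
have B0M : modulus B0.
  apply: modulus_sum => j; apply: (modulus_comp (betaM j (lexx 0))).
  by apply: modulusZ; [exact: ltW|exact: modulus_id].
have trajB (p : traj) t i : 0 <= t ->
    nrm (submxcol ((sval p).2 t) i) <= phi (B0 (a p) + gamma (v p)).
  move=> t0; case: p => -[u x] /= [ub sol].
  have sol' : ode_solution (fun t y => F y (u t)) (x 0) `[0, t + 1[ x.
    by apply: ode_solution_subset sol; apply: subset_itvl.
  have tt : 0 <= t < t + 1 by rewrite t0/= ltrDl ltr01.
  apply: le_trans (block_stability i ub sol' tt) _.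
  have [_ pm _] := phiM; apply: pm.
    apply: addr_ge0; last exact: (modulus_ge0 gammaM).
    by apply: sumr_ge0 => j _; apply: (modulus_ge0 (betaM j (lexx 0))); exact: is_norm_ge0.
  rewrite lerD2r; apply: ler_sum => j _.
  by have [_ bm _] := betaM j (lexx 0); apply: bm; [exact: is_norm_ge0|exact: HCs].
have a0 p : 0 <= a p by exact: is_norm_ge0.
have v0 p : 0 <= v p by exact: linf0.
have M2 (g : R -> R) : modulus g -> modulus (fun s => Cn * phi (2 * g s)).
  move=> gM; apply: modulusZ => //; apply: (modulus_comp phiM).
  exact: modulusZ.
have k1M : modulus (fun w => Cn * phi (gamma w)).
  by apply: modulusZ => //; exact: modulus_comp.
have [||bet [gam [betK gamK est]]] := @KL_estimate R traj a v h _ _ _ a0 v0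
    (M2 _ B0M) (M2 _ gammaM) k1M.
- move=> p t t0; rewrite -mulrDr.
  apply: (@le_trans _ _ (Cn * phi (B0 (a p) + gamma (v p)))).
    by apply: HCn => i; exact: trajB.
  rewrite ler_wpM2l//; apply: phi_add.
    exact: (modulus_ge0 B0M).
  exact: (modulus_ge0 gammaM).
- move=> r w e r0 w0 e0.
  pose fam := {p : traj | a p <= r /\ v p <= w}.
  pose y (p : fam) i t := nrm (submxcol ((sval (sval p)).2 t) i).
  pose B := phi (B0 r + gamma w).
  have rw0 : 0 <= B0 r + gamma w.
    by rewrite addr_ge0 ?(modulus_ge0 B0M) ?(modulus_ge0 gammaM).
  have B_ge0 : 0 <= B by exact: (modulus_ge0 phiM).
  have y_le p i t : 0 <= t -> y p i t <= B.
    move=> t0; case: p => p [ar vw]; apply: le_trans (trajB p t i t0) _.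
    have [_ pm _] := phiM; apply: pm.
      by rewrite addr_ge0 ?(modulus_ge0 B0M) ?(modulus_ge0 gammaM).
    have [_ b0m _] := B0M; have [_ gm _] := gammaM.
    by apply: lerD; [exact: b0m|exact: gm].
  have b0 i d : 0 < d -> exists2 T, 0 <= T & forall t, T <= t -> beta i B t <= d.
    move=> d0; have [_ /(_ B B_ge0)[anti /cvgrPdist_le/(_ _ d0)]] := betaKL i.
    move=> [T [_ HT]]; exists (Num.max 0 (T + 1)); first by rewrite le_max lexx.
    move=> t; rewrite ge_max => /andP[t0 Tt].
    have := HT t; rewrite sub0r normrN => /(_ _) /le_trans.
    move=> /(_ _ _ (lexx d)) H; apply: le_trans (ler_norm _) _; apply: H.
    lra.
  have y_est (p : fam) i s t (M : 'I_n -> R) : 0 <= s -> 0 <= t ->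
      (forall j q, s <= q -> y p j q <= M j) ->
      y p i (s + t) <= beta i B t + \sum_j gain i j (M j) + gamma w.
    move=> s0 t0 HM; have ysB := y_le p i s s0.
    case: p HM ysB => -[[u x] [/= ub sol]] [/= ar vw] HM ysB.
    rewrite /y /= in HM ysB *.
    have [ub' vs] := ess_bounded_shift nrmN s0 ub.
    have sol' : ode_solution (fun q y => F y (u (q + s))) (x s) `[0, t + 1[ (fun q => x (q + s)).
      by apply: ode_solution_subset (ode_solution_shift s0 sol); apply: subset_itvl.
    have tt : 0 <= t < t + 1 by rewrite t0/= ltrDl ltr01.
    have := subsystem_estimate nrmN (M := M) (subsystems i) (gainM i) ub' sol' tt.
    move=> /(_ _)/wrap[].
      by move=> j q /andP[q0 _]; apply: HM; rewrite lerDr.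
    rewrite [t + s]addrC => /le_trans; apply; apply: lerD.
      rewrite lerD2r; have [_ bm _] := betaM i t0; apply: bm => //.
      exact: is_norm_ge0.
    have [_ gm _] := gammaM; apply: gm; first exact: linf0.
    by apply: le_trans vs _; exact: vw.
  have e' : 0 < e / (Cn + 1) by rewrite divr_gt0// ltr_wpDl.
  have gw0 : 0 <= gamma w by exact: (modulus_ge0 gammaM).
  have [T T0 HT] := uniform_attractivity gainK y_le b0 y_est gw0
    (fun z z0 => phi_bound gw0 z0) e'.
  exists T => // p t ar vw Tt.
  have := HT (exist _ p (conj ar vw)) _ t Tt; rewrite /y /= => Ht.
  apply: le_trans (HCn _ _ Ht) _; rewrite mulrDr lerD2l mulrA ler_pdivrMr ?ltr_wpDl//.
  by rewrite mulrDr mulr1 mulrC lerDl ltW.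
exists bet, gam; split=> // x0 u x ub sol t t0.
have x00 : x 0 = x0 by apply: ode_solution0 sol; rewrite /= in_itv/= lexx.
have sol' : ode_solution (fun t y => F y (u t)) (x 0) `[0, +oo[ x by rewrite x00.
by have := est (exist _ (u, x) (conj ub sol')) t t0; rewrite /h /a /v /= x00.
Qed.

End SmallGainTheorem.

Theorem theorem4 (R : realType) (nrm : forall m, 'cV[R]_m -> R)
    (n l : nat) (N : 'I_n -> nat)
    (f : forall i, 'cV[R]_(\sum_j N j) -> 'cV[R]_l -> 'cV[R]_(N i))
    (beta : 'I_n -> R -> R -> R) (gain : 'I_n -> 'I_n -> R -> R)
    (gamma : R -> R) :
  (forall m, is_norm (nrm m)) ->
  (forall i, continuous (fun xu => f i xu.1 xu.2)) ->
  (forall i, lipschitz_on_bounded nrm (f i)) ->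
  (forall i, class_KL (beta i)) ->
  (forall i j, class_K_or_zero (gain i j)) ->
  (forall i s, 0 <= s -> gain i i s = 0) ->
  class_K gamma ->
  (forall i, subsystem_ISS nrm f i (beta i) (gain i) gamma) ->
  (exists alpha : 'I_n -> R -> R,
     (forall i, class_Kinf (alpha i)) /\
     (forall s : 'cV[R]_n, vge s 0 -> s <> 0 ->
        ~ vge ((gain_op gain \o diag_op alpha) s) s)) ->
  ISS nrm (interconnection f).
Proof.
move=> nrmN fc fl betaKL gainK _ gammaK subs [alpha [alphaK sg]].
have [phi phiM Hphi] := small_gain_bound gainK alphaK sg [set: 'I_n].
apply: (@interconnection_ISS _ _ nrmN _ _ _ _ beta gain gamma betaKL gainK gammaK
  subs phi phiM _ fc fl).
move=> w c c0 w0 wle i; apply: (Hphi w c c0) => // j _.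
by rewrite (eq_bigl predT) => [|k]; rewrite ?inE.
Qed.
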